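(* Let $n\geq 1$ and let $G$ be a transitive subgroup of $S_n$. Let $H:=G\cap S_{n-1}$, $N:=N_G(H)$, $r:=[N:H]$, and let $\pi_1,\dots,\pi_r\in S_n$ be the associated permutations (see context). Suppose $r\geq 3$ and that there exist integers $k\in[2,r-1]$ and $t\geq 2$ such that: (1) $l:=\binom{r-1}{k-1}\geq n$; (2) for some $n$ distinct vectors $\mathbf{a}_{i_1},\dots,\mathbf{a}_{i_n}$ among the vectors $\mathbf{a}_1,\dots,\mathbf{a}_l$ (defined in context from $k$ and $t$), the Jacobian matrix $\mathbb{D}=\left(\frac{\partial f_p}{\partial x_q}\right)_{1\leq p,q\leq n}$ of the trace functions $f_p:=\mathrm{Tr}_{\mathbf{a}_{i_p}}$ has determinant which is not identically $0$ (as a polynomial in $x_1,\dots,x_n$). Then $N_n(X;G)\ll X^{k+t-1}$ as $X\to\infty$, i.e. there is a constant $C>0$ independent of $X$ with $N_n(X;G)\leq C X^{k+t-1}$ for all sufficiently large $X$.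
   Context: For a number field $K$ with $[K:\mathbb{Q}]=n$, let $\widetilde{K}$ be its Galois closure in $\bar{\mathbb{Q}}$. The group $\mathrm{Gal}(\widetilde{K}/\mathbb{Q})$ permutes the $n$ embeddings $K\hookrightarrow\bar{\mathbb{Q}}$ by $\sigma\cdot\tau=\sigma\circ\tau$, making it a transitive permutation group of degree $n$. For $X>0$, $N_n(X;G)$ is the number of number fields $K\subset\bar{\mathbb{Q}}$ with $[K:\mathbb{Q}]=n$, $|\Delta_K|\leq X$ ($\Delta_K$ the discriminant), and $\mathrm{Gal}(\widetilde{K}/\mathbb{Q})$ isomorphic to $G$ as permutation subgroups of $S_n$. Here $S_{n-1}$ denotes the stabilizer of $1$ in $S_n$. Choose left coset representatives $g_1,\dots,g_n$ of $H$ in $G$ with $g_1\in H$ and such that $g_1H,\dots,g_rH$ are exactly the cosets of $H$ contained in $N$. For $j\in[1,r]$ and $i\in[1,n]$, since $g_j$ normalizes $H$, $g_ig_jH$ is a left coset of $H$, and $\pi_j\in S_n$ is defined by $g_ig_jH=g_{\pi_j(i)}H$. For $\mathbf{a}=(a_1,\dots,a_r)\in\mathbb{Z}_{\geq0}^r$, the trace function is $\mathrm{Tr}_{\mathbf{a}}(x_1,\dots,x_n):=\sum_{i=1}^n\prod_{j=1}^r x_{\pi_j(i)}^{a_j}\in\mathbb{Z}[x_1,\dots,x_n]$. Given $k,t$, let $\mathcal{S}_k(r)$ be the set of $k$-element subsets of $\{1,\dots,r\}$ containing $1$, enumerated as $\mathcal{B}_1,\dots,\mathcal{B}_l$ with $l=\binom{r-1}{k-1}$;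 for $\mathcal{B}\in\mathcal{S}_k(r)$ let $\mathbf{a}(\mathcal{B})=(a_1,\dots,a_r)$ with $a_1=t$, $a_i=1$ if $i\neq1$ and $i\in\mathcal{B}$, and $a_i=0$ otherwise; set $\mathbf{a}_i:=\mathbf{a}(\mathcal{B}_i)$. *)

(* Defs.v *)
From HB Require Import structures.
From mathcomp Require Import all_boot all_order all_fingroup all_algebra.
From mathcomp Require Import all_solvable all_field.
From mathcomp Require Import boolp classical_sets functions cardinality.
From mathcomp Require Import reals constructive_ereal measure.
From mathcomp Require mpoly.
(* The notations of mpoly are incompatible with those of classical_sets. *)
Export (canonicals, coercions) mpoly.

Set Implicit Arguments.
Unset Strict Implicit.
Unset Printing Implicit Defensive.

Import Order.TTheory GRing.Theory Num.Theory.

Local Open Scope ring_scope.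

(** Points 1, ..., n are the elements 0, ..., n - 1 of ['I_n]; the field
    [algC] of algebraic complex numbers is the algebraic closure of Q. *)

Definition enumerates_embeddings (n : nat) (L : fieldExtType rat)
    (e : 'I_n -> {rmorphism L -> algC}) : Prop :=
  (forall i j, e i =1 e j -> i = j) /\
  (forall tau : {rmorphism L -> algC}, exists i, tau =1 e i).

Definition integral_basis (n : nat) (L : fieldExtType rat) (w : 'I_n -> L) :
    Prop :=
  (forall j, integralOver (intr : int -> L) (w j)) /\
  (forall x : L, integralOver (intr : int -> L) x ->
     exists! c : {ffun 'I_n -> int}, x = \sum_(j < n) w j *~ c j).

Definition is_discriminant (n : nat) (L : fieldExtType rat) (d : int) : Prop :=
  exists (e : 'I_n -> {rmorphism L -> algC}) (w : 'I_n -> L),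
    [/\ enumerates_embeddings e, integral_basis w &
        d%:~R = (\det (\matrix_(i < n, j < n) e i (w j))) ^+ 2].

Definition is_galois_closure (K : set algC) (M : splittingFieldType rat)
    (jM : {rmorphism M -> algC}) : Prop :=
  [/\ galois 1 {:M}, (K `<=` range jM)%classic &
      forall (M' : splittingFieldType rat) (j' : {rmorphism M' -> algC}),
        galois 1 {:M'} -> (K `<=` range j')%classic ->
        (range jM `<=` range j')%classic].

(** [tau'] is [sigma] composed after [tau], the automorphism [sigma] of [M]
    being transported to the subfield [range jM] of [algC]. *)
Definition is_galois_translate (L : fieldExtType rat)
    (M : splittingFieldType rat) (jM : {rmorphism M -> algC})
    (sigma : gal_of {:M}%AS) (tau tau' : {rmorphism L -> algC}) : Prop :=
  forall (x : L) (y : M), tau x = jM y -> tau' x = jM (sigma y).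

(** Products in both ['S_n] and ['Gal(_ / _)] mean "first the left factor, then
    the right one", so [psi] respects the two left actions. *)
Definition has_galois_group (n : nat) (G : {group 'S_n}) (L : fieldExtType rat)
    (iota : {rmorphism L -> algC}) : Prop :=
  exists (M : splittingFieldType rat) (jM : {rmorphism M -> algC})
         (e : 'I_n -> {rmorphism L -> algC})
         (psi : {morphism 'Gal({:M} / 1)%g >-> 'S_n}),
    [/\ is_galois_closure (range iota) jM,
        enumerates_embeddings e,
        isom 'Gal({:M} / 1)%g G psi &
        forall (sigma : gal_of {:M}%AS) (i : 'I_n),
          sigma \in 'Gal({:M} / 1)%g ->
          is_galois_translate jM sigma (e i) (e (psi sigma i))].

Definition number_fields (R : realType) (n : nat) (X : R) (G : {group 'S_n}) :
    set (set algC) :=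
  [set K | exists (L : fieldExtType rat) (iota : {rmorphism L -> algC}),
     [/\ K = range iota,
         \dim {:L} = n,
         exists2 d : int, is_discriminant n L d & `|d|%:~R <= X &
         has_galois_group G iota]]%classic.

(** [counting] is [+oo] on infinite sets. *)
Definition field_count (R : realType) (n : nat) (X : R) (G : {group 'S_n}) :
    \bar R :=
  counting (number_fields X G).

Definition point_stab (n : nat) (n_gt0 : (0 < n)%N) (G : {group 'S_n}) :
    {group 'S_n} :=
  'C_G[Ordinal n_gt0 | 'P]%G.

(** Since [(s * u) x = u (s x)] in ['S_n], the left coset of [H] by [g] for
    composition of functions, i.e. all [g \o h] with [h] in [H], is the set
    [H :* g]. *)
Definition adapted_coset_reps (n : nat) (n_gt0 : (0 < n)%N) (G : {group 'S_n})
    (r : nat) (g : 'I_n -> 'S_n) : Prop :=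
  let H := point_stab n_gt0 G in
  [/\ forall i, g i \in G,
      injective (fun i => H :* g i)%g,
      rcosets H G = [set (H :* g i)%g | i : 'I_n]%SET,
      g (Ordinal n_gt0) \in H &
      forall i : 'I_n, ((H :* g i)%g \subset 'N_G(H)%g) = (i < r)%N].

(** [j'] is [j] seen as an index of [g]; for composition of functions,
    the equation reads [g_i g_j H = g_(pi_j(i)) H]. *)
Definition coset_permutations (n : nat) (n_gt0 : (0 < n)%N) (G : {group 'S_n})
    (r : nat) (g : 'I_n -> 'S_n) (pi : 'I_r -> 'S_n) : Prop :=
  let H := point_stab n_gt0 G in
  forall (j : 'I_r) (j' i : 'I_n), j' = j :> nat ->
    (H :* (g j' * g i) = H :* g (pi j i))%g.

Definition trace_function (n r : nat) (pi : 'I_r -> 'S_n)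
    (a : {ffun 'I_r -> nat}) : mpoly.mpoly n int :=
  \sum_(i < n) \prod_(j < r)
    mpoly.mpolyX int (mpoly.mnm1 (pi j i)) ^+ a j.

Definition jacobian (n : nat) (f : 'I_n -> mpoly.mpoly n int) :
    'M[mpoly.mpoly n int]_n :=
  \matrix_(p < n, q < n) mpoly.mderiv q (f p).

Definition pointed_subsets (r k : nat) : {set {set 'I_r}} :=
  [set B : {set 'I_r} | (#|B| == k) && [exists j in B, j == 0%N :> nat]]%SET.

Definition exponent_of_subset (r t : nat) (B : {set 'I_r}) :
    {ffun 'I_r -> nat} :=
  [ffun i : 'I_r => if i == 0%N :> nat then t else (i \in B : nat)].

Definition exponent_vector (r k t : nat) (i : 'I_#|pointed_subsets r k|) :
    {ffun 'I_r -> nat} :=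
  exponent_of_subset t (enum_val i).

(* Main.v *)
(** Proof idea.  Write [m = k + t - 1], the common degree of the trace functions
    [f_p].  A nonzero vector of the dual of the ring of integers has norm at
    least [1/|d|], so the dual lattice has no vector shorter than about
    [|d|^(-1/n)]; by transference the ring of integers has a basis whose
    conjugates are all [O(|d|^(1/n))].  A small integral combination of this
    basis gives an integral element [x] whose conjugates [x_i] avoid any
    prescribed hypersurface and are still [O(X^(1/n))].  The values [f_p(x_i)]
    are fixed by the Galois group, because the [pi_j] commute with its action on
    cosets; so they are integers of size [O(X^(m/n))], which leaves [O(X^m)]
    possible [n]-tuples.  The Jacobian criterion makes the [f_p] algebraically
    independent, hence each coordinate [x_i] is algebraic over them, and off a
    hypersurface a tuple of values determines each [x_i], and the field it
    generates, up to finitely many choices. *)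

Require Import Defs.
From HB Require Import structures.
From mathcomp Require Import all_boot all_order all_fingroup all_algebra.
From mathcomp Require Import all_solvable all_field.
From mathcomp Require Import boolp classical_sets functions cardinality.
From mathcomp Require Import reals constructive_ereal measure.
From mathcomp Require mpoly.
From mathcomp Require Import ring lra zify.
Import -(notations) mpoly.

Set Implicit Arguments.
Unset Strict Implicit.
Unset Printing Implicit Defensive.

Import Order.TTheory GRing.Theory Num.Theory.
Local Open Scope ring_scope.

(** * Polynomial algebra *)

(** The chain rule for any derivation that kills the constants: it serves for partial derivatives in
    the Jacobian criterion and for the derivative along a line. *)
Lemma mmap_derivation (R S : comNzRingType) n (f : {rmorphism R -> S})
    (h : 'I_n -> S) (D : S -> S) :
  {morph D : x y / x + y} -> (forall x y, D (x * y) = D x * y + x * D y) ->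
  (forall c, D (f c) = 0) ->
  forall p, D (mmap f h p) = \sum_(i < n) mmap f h (mderiv i p) * D (h i).
Proof.
move=> DD DM Df; pose P p := D (mmap f h p) =
  \sum_(i < n) mmap f h (mderiv i p) * D (h i).
have D0 : D 0 = 0 by have := Df 0; rewrite rmorph0.
have P0 : P 0.
  by rewrite /P mmap0 D0 big1 // => i _; rewrite mderiv0 mmap0 mul0r.
have PC c : P (mpolyC n c).
  by rewrite /P mmapC Df big1 // => i _; rewrite mderivC mmap0 mul0r.
have PD p q : P p -> P q -> P (p + q).
  rewrite /P mmapD DD => -> ->; rewrite -big_split /=.
  by apply: eq_bigr => i _; rewrite mderivD mmapD mulrDl.
have PM p q : P p -> P q -> P (p * q).
  rewrite /P rmorphM DM => -> ->; rewrite mulr_suml mulr_sumr -big_split /=.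
  apply: eq_bigr => i _; rewrite mderivM rmorphD !rmorphM /=.
  ring.
have PX i : P (mpolyX R (mnm1 i)).
  rewrite /P mmapX mmap1U (bigD1 i) //= mderivX.
  have -> : mnm_sub (mnm1 i) (mnm1 i) = mnm0.
    by apply/mnmP => j; rewrite mnmBE subnn mnm0E.
  rewrite mnm1E eqxx scale1r big1 ?addr0; first by rewrite mmapX mmap11 mul1r.
  by move=> j ji; rewrite mderivX mnm1E eq_sym (negbTE ji) scale0r mmap0 mul0r.
have P1 : P 1 by rewrite -mpolyC1.
move=> p; rewrite -/(P p) [p]mpolyE; apply: (big_ind P P0 PD) => m _.
rewrite -mul_mpolyC; apply: (PM _ _ (PC _)); rewrite mpolyXE_id.
apply: (big_ind P P1 PM) => i _; elim: (m i) => [|k IH]; first by rewrite expr0.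
by rewrite exprS; apply: PM.
Qed.

(** Characteristic zero enters here: the coefficient of [p] at [m], times the positive integer
    [m i], is a coefficient of [mderiv i p]. *)
Lemma mderiv_eq0_mpolyC (R : numDomainType) n (p : mpoly n R) :
  (forall i, mderiv i p = 0) -> p = mpolyC n (mcoeff mnm0 p).
Proof.
move=> dp0; apply/mpolyP => m; rewrite mcoeffC.
case: eqVneq => [<-|m0]; first by rewrite mulr1.
have [i mi] : exists i, (0 < m i)%N.
  apply/existsP; apply: contraR m0 => /existsPn m0; apply/eqP/mnmP => i.
  by rewrite mnm0E; have := m0 i; rewrite -leqNgt leqn0 => /eqP->.
rewrite mulr0; have := congr1 (mcoeff (mnm_sub m (mnm1 i))) (dp0 i).
rewrite mcoeff_deriv mcoeff0 submK => [|]; last first.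
  by apply/mnm_lepP => j; rewrite mnm1E; case: eqVneq => // <-.
by move/eqP; rewrite mulrn_eq0 /= => /eqP.
Qed.

Lemma msize_mderiv (R : nzRingType) n (p : mpoly n R) i :
  p != 0 -> (msize (mderiv i p) < msize p)%N.
Proof.
move=> p0; have [->|q0] := eqVneq (mderiv i p) 0.
  by rewrite msize0 lt0n msize_poly_eq0.
rewrite -(mlead_deg q0); set m := mlead _.
have mq : m \in msupp (mderiv i p) by rewrite mlead_supp.
have : mnm_add m (mnm1 i) \in msupp p.
  rewrite mcoeff_msupp; move: mq; rewrite mcoeff_msupp mcoeff_deriv.
  by apply: contraNneq => ->; rewrite mul0rn.
by move/msize_mdeg_lt; rewrite mdegD mdeg1 addn1.
Qed.

(** Differentiating a relation [P] shows that its partial derivatives, evaluated at [f], form a row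
    killed by the Jacobian matrix. They vanish, so they are relations of smaller size, zero by
    induction, and [P] is constant. *)
Lemma jacobian_alg_indep (R : numDomainType) n (f : 'I_n -> mpoly n R) :
  \det (\matrix_(p < n, q < n) mderiv q (f p)) != 0 ->
  forall P : mpoly n R, mmap (@mpolyC n R) f P = 0 -> P = 0.
Proof.
move=> detJ P; have [k] := ubnP (msize P).
elim: k => // k IH in P *; rewrite ltnS => Pk Pf0.
apply/eqP; apply: contraT => P0.
have dP i : mderiv i P = 0.
  have dk := leq_trans (msize_mderiv i P0) Pk.
  apply: IH => //; move: i {dk}; set J := \matrix_(_, _) _ in detJ.
  pose v := \row_p mmap (@mpolyC n R) f (mderiv p P).
  have vJ : v *m J = 0.
    apply/rowP => q; rewrite !mxE.
    under eq_bigr do rewrite !mxE.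
    rewrite -(@mmap_derivation _ _ _ (@mpolyC n R) f (mderiv q)) ?Pf0 ?mderiv0//.
    - exact: mderivD.
    - exact: mderivM.
    - by move=> c; rewrite mderivC.
  have : v *m (J *m \adj J) = 0 by rewrite mulmxA vJ mul0mx.
  rewrite mul_mx_adj mul_mx_scalar => /rowP v0 i; apply/eqP.
  by have /eqP := v0 i; rewrite !mxE mulf_eq0 (negbTE detJ).
move: Pf0 P0; rewrite (mderiv_eq0_mpolyC dP) mmapC => /eqP.
by rewrite !mpolyC_eq0 => ->.
Qed.

Definition restrict_line (R : comNzRingType) n (x v : 'I_n -> R)
    (p : mpoly n R) : {poly R} :=
  mmap (@polyC R) (fun i => (x i)%:P + v i *: 'X) p.

Lemma horner_restrict_line (R : comNzRingType) n (x v : 'I_n -> R) p t :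
  (restrict_line x v p).[t] = meval (fun i => x i + v i * t) p.
Proof.
rewrite /restrict_line /meval /mmap horner_sum; apply: eq_bigr => m _.
rewrite hornerM hornerC /mmap1 horner_prod; congr (_ * _).
by apply: eq_bigr => i _; rewrite horner_exp !hornerE.
Qed.

Lemma size_restrict_line (R : comNzRingType) n (x v : 'I_n -> R) p :
  (size (restrict_line x v p) <= msize p)%N.
Proof.
rewrite /restrict_line /mmap big_seq.
apply: (big_ind (fun q : {poly R} => size q <= msize p)%N) => [|q1 q2 s1 s2|m].
- by rewrite size_poly0.
- by rewrite (leq_trans (size_polyD _ _)) // geq_max s1.
move/msize_mdeg_lt; apply: leq_trans; rewrite mul_polyC.
apply: leq_trans (size_scale_leq _ _) _; rewrite /mmap1 mdegE.
apply: (big_ind2 (fun (q : {poly R}) k => size q <= k.+1)%N) => [|q1 a q2 b s1 s2|i _].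
- by rewrite size_poly1.
- apply: leq_trans (size_polyMleq _ _) _; lia.
elim: (m i) => [|k IH]; first by rewrite expr0 size_poly1.
rewrite exprS; apply: leq_trans (size_polyMleq _ _) _.
have : (size ((x i)%:P + v i *: 'X)%R <= 2)%N.
  apply: leq_trans (size_polyD _ _) _; rewrite geq_max size_polyC.
  by rewrite (leq_trans (size_scale_leq _ _)) ?size_polyX ?andbT //; case: eqP.
lia.
Qed.

Lemma deriv_restrict_line (R : comNzRingType) n (x v : 'I_n -> R) p :
  (restrict_line x v p)^`() =
  \sum_(i < n) v i *: restrict_line x v (mderiv i p).
Proof.
rewrite /restrict_line (@mmap_derivation _ _ _ (@polyC R) _ (@deriv R)).
- by apply: eq_bigr => i _; rewrite derivD derivC add0r derivZ derivX mulrC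
                              -!mul_polyC mulr1.
- exact: derivD.
- exact: derivM.
- exact: derivC.
Qed.

Lemma poly_nat_nonroot (R : numDomainType) (p : {poly R}) d :
  p != 0 -> (size p <= d)%N -> exists2 c : nat, (c < d)%N & p.[c%:R] != 0.
Proof.
move=> p0 pd; pose rs := [seq i%:R : R | i <- iota 0 d].
have : ~~ all (root p) rs.
  apply: contra p0 => rootp; apply/eqP/(roots_geq_poly_eq0 rootp).
    by rewrite map_inj_uniq ?iota_uniq // => i j /eqP; rewrite eqr_nat => /eqP.
  by rewrite size_map size_iota.
by move/allPn => [_ /mapP[c + ->]]; rewrite mem_iota; exists c.
Qed.

(** The restriction of [p] to a line in a coordinate direction has too many roots, so it is zero and
    so is its derivative. The partial derivatives thus vanish everywhere and induction on the size
    applies. *)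
Lemma meval_eq0 (R : numDomainType) n (p : mpoly n R) :
  (forall x, meval x p = 0) -> p = 0.
Proof.
have [k] := ubnP (msize p); elim: k => // k IH in p *; rewrite ltnS => pk px0.
apply/eqP; apply: contraT => p0.
have dp i : mderiv i p = 0.
  apply: IH => [|x]; first exact: leq_trans (msize_mderiv i p0) pk.
  pose v j : R := (j == i)%:R.
  have l0 : restrict_line x v p = 0.
    apply/eqP; apply: contraT => l0.
    have [c _ /eqP[]] := poly_nat_nonroot l0 (leqnn _).
    by rewrite horner_restrict_line px0.
  have := deriv_restrict_line x v p; rewrite l0 deriv0.
  rewrite (bigD1 i) //= big1 => [|j ji]; last by rewrite /v (negbTE ji) scale0r.
  rewrite addr0 /v eqxx scale1r => /(congr1 (horner^~ 0)) /=.
  rewrite horner_restrict_line horner0 => /esym <-.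
  by apply: meval_eq => j; rewrite mulr0 addr0.
have pC := mderiv_eq0_mpolyC dp; have := px0 (fun=> 0).
by move: p0; rewrite pC mevalC mpolyC_eq0 => /eqP.
Qed.

(** Starting from any combination of the rows of [V] off the zero locus, the coefficients are made
    small naturals one at a time: on each line [p] has fewer than [msize p] zeros. *)
Lemma mpoly_grid_neq0 (R : numFieldType) n (p : mpoly n R) (V : 'M[R]_n) :
  p != 0 -> V \in unitmx ->
  exists c : 'I_n -> 'I_(msize p),
    meval (fun i => \sum_j (c j)%:R * V j i) p != 0.
Proof.
move=> p0 Vu; pose ev (c : 'I_n -> R) := meval (fun i => \sum_j c j * V j i) p.
have [c0 evc0] : exists c, ev c != 0.
  apply: contrapT => /forallNP ev0; case/eqP: p0; apply: meval_eq0 => x.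
  have /negP/negPn/eqP := ev0 (fun j => (\row_i x i *m invmx V) 0 j).
  move=> <-; apply: meval_eq => i.
  transitivity (((\row_i x i) *m invmx V *m V) 0 i); last by rewrite mxE.
  by rewrite mulmxKV // mxE.
have key k : (k <= n)%N -> exists2 c, ev c != 0 &
    forall j : 'I_n, (j < k)%N -> exists a : 'I_(msize p), c j = a%:R.
  elim: k => [_|k IH kn]; first by exists c0.
  have [c evc ck] := IH (ltnW kn); pose j0 := Ordinal kn.
  pose l := restrict_line (fun i => \sum_(j | j != j0) c j * V j i)
                          (fun i => V j0 i) p.
  have lE t : l.[t] = ev (fun j => if j == j0 then t else c j).
    rewrite horner_restrict_line; apply: meval_eq => i.
    rewrite [RHS](bigD1 j0) //= eqxx addrC mulrC; congr (_ + _).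
    by apply: eq_bigr => j /negbTE->.
  have l0 : l != 0.
    apply: contraNneq evc => l0; have := lE (c j0); rewrite l0 horner0 => ->.
    by apply/eqP; apply: meval_eq => i; apply: eq_bigr => j _; case: eqP => [->|].
  have [a ap la] := poly_nat_nonroot l0 (size_restrict_line _ _ _).
  exists (fun j => if j == j0 then a%:R else c j); first by rewrite -lE.
  move=> j; rewrite ltnS leq_eqVlt -[(j : nat) == k]/(j == j0).
  by case: eqVneq => [_ _|_ /ck//]; exists (Ordinal ap).
have [c evc /(_ _ (ltn_ord _)) ck] := key n (leqnn n).
have [a ac] := fin_all_exists ck; exists a.
apply: contraNneq evc => <-; apply/eqP/meval_eq => i.
by apply: eq_bigr => j _; rewrite ac.
Qed.

Definition mnm_of_ffun n b (a : {ffun 'I_n -> 'I_b}) : multinom n :=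
  Multinom [tuple (a i : nat) | i < n].

Lemma mnm_of_ffunE n b (a : {ffun 'I_n -> 'I_b}) i : mnm_of_ffun a i = a i.
Proof. exact: mnmE. Qed.

Lemma mnm_of_ffun_inj n b : injective (@mnm_of_ffun n b).
Proof.
move=> a a' /mnmP aa'; apply/ffunP => i; apply: val_inj.
by have := aa' i; rewrite !mnm_of_ffunE.
Qed.

Lemma mpoly_box_eq0 (R : nzRingType) n b (p : mpoly n R) :
  (msize p <= b)%N ->
  (forall a : {ffun 'I_n -> 'I_b}, mcoeff (mnm_of_ffun a) p = 0) -> p = 0.
Proof.
move=> pb p0; apply/mpolyP => m; rewrite mcoeff0.
have [mb|mb] := ltnP (mdeg m) b; last first.
  by apply: memN_msupp_eq0; apply: msize_mdeg_ge; apply: leq_trans mb.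
have mib i : (m i < b)%N.
  by apply: leq_ltn_trans mb; rewrite mdegE (bigD1 i) //= leq_addr.
rewrite -(p0 [ffun i => Ordinal (mib i)]); congr (mcoeff _ p).
by apply/mnmP => i; rewrite mnm_of_ffunE ffunE.
Qed.

Lemma msize_mulS (R : idomainType) n (p q : mpoly n R) a b :
  (msize p <= a.+1)%N -> (msize q <= b.+1)%N -> (msize (p * q) <= (a + b).+1)%N.
Proof.
move=> pa qb; have [->|p0] := eqVneq p 0; first by rewrite mul0r msize0.
have [->|q0] := eqVneq q 0; first by rewrite mulr0 msize0.
by rewrite msizeM //; lia.
Qed.

Lemma msize_expS (R : idomainType) n (p : mpoly n R) a k :
  (msize p <= a.+1)%N -> (msize (p ^+ k) <= (k * a).+1)%N.
Proof.
move=> pa; elim: k => [|k IH]; first by rewrite expr0 msize1.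
by rewrite exprS mulSn msize_mulS.
Qed.

(* The products of powers of [f] and [y] with exponents below [D] outnumber the
   monomials in which they expand. *)
Lemma mpoly_alg_dep (F : fieldType) n (f : 'I_n -> mpoly n F) (y : mpoly n F) :
  exists (D : nat) (u : 'I_D -> mpoly n F),
    (exists s, u s != 0) /\
    \sum_(s < D) mmap (@mpolyC n F) f (u s) * y ^+ s = 0.
Proof.
pose d := maxn (\max_i msize (f i)) (msize y).
have fd i : (msize (f i) <= d.+1)%N.
  by rewrite leqW // leq_max (leq_bigmax (F := fun i => msize (f i))).
have yd : (msize y <= d.+1)%N by rewrite leqW // leq_max leqnn orbT.
(* The products have size at most [(n + 1) * d * D + 1], hence at most [c * D]. There are
   [D ^ (n + 1)] of them against [c ^ n * D ^ n] exponent vectors, and [D] exceeds [c ^ n]. *)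
pose c := (n.+1 * d).+1; pose D := (c ^ n).+1.
pose T1 : finType := ({ffun 'I_n -> 'I_D} * 'I_D)%type.
pose T2 : finType := {ffun 'I_n -> 'I_(c * D)}.
pose P (t : T1) := mmap1 f (mnm_of_ffun t.1) * y ^+ t.2.
have sP t : (msize (P t) <= c * D)%N.
  have : (msize (P t) <= (\sum_(i < n) t.1 i * d + t.2 * d).+1)%N.
    apply: msize_mulS; last exact: msize_expS.
    apply: (big_ind2 (fun (q : mpoly n F) k => msize q <= k.+1)%N).
    - by rewrite msize1.
    - by move=> p a q b pa qb; apply: msize_mulS.
    - by move=> i _; rewrite mnm_of_ffunE msize_expS.
  move/leq_trans; apply.
  have : (\sum_(i < n) t.1 i * d <= \sum_(i < n) D * d)%N.
    by apply: leq_sum => i _; rewrite leq_mul2r ltnW ?orbT.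
  have : (t.2 * d <= D * d)%N by rewrite leq_mul2r ltnW ?orbT.
  have D0 : (0 < D)%N by [].
  rewrite sum_nat_const card_ord /c; nia.
pose A := \matrix_(i < #|T1|, j < #|T2|)
  mcoeff (mnm_of_ffun (enum_val j)) (P (enum_val i)).
have : kermx A != 0.
  rewrite kermx_eq0; apply: contraTN (rank_leq_col A) => /eqP ->.
  rewrite -ltnNge card_prod !card_ffun !card_ord expnMn mulnC ltn_pmul2l //.
  by rewrite expn_gt0.
case/rowV0Pn => v /sub_kermxP vA v0.
exists D, (fun s => \sum_(a : {ffun 'I_n -> 'I_D})
  v 0 (enum_rank ((a, s) : T1)) *: mpolyX F (mnm_of_ffun a)); split.
  have [i vi] : exists i, v 0 i != 0.
    apply/existsP; apply: contraR v0 => /existsPn v0; apply/eqP/rowP => i.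
    by rewrite mxE; apply/eqP; rewrite -[_ == _]negbK v0.
  exists (enum_val i).2; apply: contraNneq vi.
  move=> /(congr1 (mcoeff (mnm_of_ffun (enum_val i).1))).
  rewrite mcoeff0 raddf_sum (bigD1 (enum_val i).1) //= mcoeffZ mcoeffX eqxx mulr1.
  rewrite big1 ?addr0 => [|a ai]; first by rewrite -surjective_pairing enum_valK => ->.
  by rewrite mcoeffZ mcoeffX (inj_eq (@mnm_of_ffun_inj _ _)) (negbTE ai) mulr0.
have -> : \sum_(s < D) mmap (@mpolyC n F) f (\sum_(a : {ffun 'I_n -> 'I_D})
    v 0 (enum_rank ((a, s) : T1)) *: mpolyX F (mnm_of_ffun a)) * y ^+ s =
  \sum_(t : T1) v 0 (enum_rank t) *: P t.
  rewrite (eq_bigr (fun t : T1 =>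
    v 0 (enum_rank (t.1, t.2)) *: P (t.1, t.2))); last by case.
  rewrite -(pair_bigA _ (fun a s => v 0 (enum_rank ((a, s) : T1)) *: P (a, s))).
  rewrite exchange_big /=.
  apply: eq_bigr => s _; rewrite raddf_sum mulr_suml; apply: eq_bigr => a _.
  by rewrite /= mmapZ mmapX -mulrA mul_mpolyC.
apply: (@mpoly_box_eq0 _ _ (c * D)) => [|a].
  apply: (big_ind (fun q : mpoly n F => msize q <= c * D)%N) => [|p q ps qs|t _].
  - by rewrite msize0.
  - by apply: leq_trans (msizeD_le _ _) _; rewrite geq_max ps.
  - exact: leq_trans (msizeZ_le _ _) (sP t).
move/rowP/(_ (enum_rank a)): vA; rewrite !mxE => <-; rewrite raddf_sum /=.
rewrite (reindex (enum_val : 'I_#|T1| -> T1)); last exact: onW_bij (@enum_val_bij T1).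
by apply: eq_bigr => i _; rewrite mcoeffZ mxE enum_valK enum_rankK.
Qed.

(** * Reduction of quadratic forms *)

Definition qform (R : comNzRingType) n (S : 'M[R]_n) (x : 'rV[R]_n) : R :=
  (x *m S *m x^T) 0 0.

Lemma qform_mulmx (R : comNzRingType) m n (S : 'M[R]_n) (U : 'M_(m, n)) x :
  qform S (x *m U) = qform (U *m S *m U^T) x.
Proof. by rewrite /qform trmx_mul !mulmxA. Qed.

Lemma qform_row (R : comNzRingType) m n (S : 'M[R]_n) (U : 'M_(m, n)) i :
  (U *m S *m U^T) i i = qform S (row i U).
Proof. by rewrite /qform -row_mul tr_row colE mulmxA -row_mul -colE !mxE. Qed.

Lemma qform_subZ (R : comNzRingType) n (S : 'M[R]_n) x t y :
  qform S (x - t *: y) =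
  qform S x - t * (x *m S *m y^T) 0 0 - t * (y *m S *m x^T) 0 0 +
  t ^+ 2 * qform S y.
Proof.
have tr : (x - t *: y)^T = x^T - t *: y^T by apply/matrixP => i j; rewrite !mxE.
rewrite /qform tr !(mulmxBl, mulmxBr).
rewrite -!scalemxAl -!scalemxAr.
move: (x *m S *m x^T) (x *m S *m y^T) (y *m S *m x^T) (y *m S *m y^T) => a b c d.
rewrite !mxE; ring.
Qed.

Lemma invmx_sym (R : comUnitRingType) n (S T : 'M[R]_n) :
  S^T = S -> S *m T = 1%:M -> T^T = T.
Proof.
move=> Ssym ST; have TtS : T^T *m S = 1%:M by rewrite -{1}Ssym -trmx_mul ST trmx1.
by rewrite -[T^T]mulmx1 -ST mulmxA TtS mul1mx.
Qed.

Lemma qform_inv (R : comUnitRingType) n (S T : 'M[R]_n) z :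
  S^T = S -> S *m T = 1%:M -> qform T z = qform S (z *m T).
Proof.
move=> Ssym ST; rewrite qform_mulmx (invmx_sym Ssym ST) (mulmx1C ST).
by rewrite mul1mx.
Qed.

(** For a Gram matrix [A], this is the Gram matrix of the last [n] basis vectors projected
    orthogonally to the first. *)
Definition schur_compl (R : fieldType) n (A : 'M[R]_(1 + n)) : 'M[R]_n :=
  drsubmx A - (A 0 0)^-1 *: ((ursubmx A)^T *m ursubmx A).

(** Completing the square in the first coordinate. *)
Lemma qform_row_mx (R : fieldType) n (A : 'M[R]_(1 + n)) c x :
  A^T = A -> A 0 0 != 0 ->
  qform A (row_mx c%:M x) =
    A 0 0 * (c + (x *m (ursubmx A)^T) 0 0 / A 0 0) ^+ 2 +
    qform (schur_compl A) x.
Proof.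
move=> Asym a0; set a := A 0 0 in a0 *; set b := ursubmx A.
have dlA : dlsubmx A = b^T by rewrite /b -[in RHS]Asym -trmx_dlsub trmxK.
have ulA : ulsubmx A = a%:M.
  rewrite [LHS]mx11_scalar; congr _%:M; rewrite !mxE /a; congr (A _ _); exact: val_inj.
rewrite /qform -[in LHS](submxK A) dlA ulA -/b mul_row_block tr_row_mx mul_row_col.
rewrite tr_scalar_mx /schur_compl -/a -/b mulmxBr mulmxBl -scalemxAr -scalemxAl.
have -> : x *m (b^T *m b) *m x^T = (x *m b^T) *m (x *m b^T)^T.
  by rewrite trmx_mul trmxK !mulmxA.
rewrite !mulmxDl -!scalar_mxM mul_scalar_mx mul_mx_scalar -scalemxAl.
have -> : b *m x^T = (x *m b^T)^T by rewrite trmx_mul trmxK.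
move: (x *m b^T) (x *m drsubmx A *m x^T) => y w.
rewrite !mxE big_ord1 !mxE eqxx mulr1n; field.
exact: a0.
Qed.

(** The upper right block of [A *m B = 1%:M] expresses [ursubmx B] by [drsubmx B]; substitute in the
    lower right one. The dual of the projected lattice is thus the part of the dual lattice with
    zero first coordinate. *)
Lemma schur_complP (R : fieldType) n (A B : 'M[R]_(1 + n)) :
  A^T = A -> A 0 0 != 0 -> A *m B = 1%:M -> schur_compl A *m drsubmx B = 1%:M.
Proof.
move=> Asym a0; set a := A 0 0 in a0 *.
have dlA : dlsubmx A = (ursubmx A)^T by rewrite -[in RHS]Asym -trmx_dlsub trmxK.
have ulA : ulsubmx A = a%:M.
  rewrite [LHS]mx11_scalar; congr _%:M; rewrite !mxE /a; congr (A _ _); exact: val_inj.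
rewrite -{1}(submxK A) -{1}(submxK B) mulmx_block (scalar_mx_block 1 n 1).
rewrite dlA ulA => /eq_block_mx[_ + _ <-]; rewrite mul_scalar_mx => /eqP.
rewrite addr_eq0 => /eqP/(congr1 (fun M => a^-1 *: M)).
rewrite scalerA mulVf // scale1r => ->.
rewrite /schur_compl mulmxBl -scalemxAl -mulmxA -scalemxAr.
by rewrite mulmxN scalerN addrC.
Qed.

Lemma qform_row0mx (R : comNzRingType) n (A : 'M[R]_(1 + n)) x :
  qform A (row_mx 0 x) = qform (drsubmx A) x.
Proof.
rewrite /qform -[in LHS](submxK A) mul_row_block tr_row_mx mul_row_col.
by rewrite !mul0mx !add0r trmx0 mulmx0 add0r.
Qed.

Section DualReduction.
Variable R : archiRealFieldType.

Local Notation intmx := (map_mx (intr : int -> R)).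

Lemma intmx_eq0 m n (M : 'M[int]_(m, n)) : (intmx M == 0) = (M == 0).
Proof.
apply/eqP/eqP => [/matrixP M0|->]; last by rewrite map_mx0.
apply/matrixP => i j; have /eqP := M0 i j.
by rewrite !mxE intr_eq0 => /eqP.
Qed.

Definition posdef n (S : 'M[R]_n) := forall x, x != 0 -> 0 < qform S x.

(** If [x] fails, some other point has less than half its value, and in an archimedean field only
    finitely many halvings stay above [e]. This stands in for the existence of a shortest vector. *)
Lemma near_minimum (X : Type) (f : X -> R) (e : R) (x0 : X) :
  0 < e -> (forall x, e <= f x) -> exists x, forall y, f x <= 2 * f y.
Proof.
move=> e0 ef.
have key k : forall x, f x <= 2 ^+ k * e -> exists x, forall y, f x <= 2 * f y.
  elim: k => [|k IH] x fx.
    by exists x => y; have := ef y; rewrite expr0 in fx; lra.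
  have [xmin|/existsNP[y]] := pselect (forall y, f x <= 2 * f y); first by exists x.
  by move/negP; rewrite -ltNge => fy; apply: (IH y); rewrite exprS in fx; lra.
have fe0 : 0 <= f x0 / e by rewrite divr_ge0 ?ltW // (lt_le_trans e0).
apply: (key (Num.bound (f x0 / e)) x0).
rewrite -ler_pdivrMr //; apply: (le_trans (ltW (archi_boundP fe0))).
by rewrite -natrX ler_nat ltnW // ltn_expl.
Qed.

(** Cauchy-Schwarz against row [i] of [T] bounds [x_i ^ 2] by [qform S x * T i i], and a nonzero
    integral vector has a coordinate whose square is at least 1. *)
Lemma posdef_int_lower_bound n (S T : 'M[R]_n) :
  S^T = S -> posdef S -> S *m T = 1%:M ->
  exists2 e : R, 0 < e & forall x : 'rV[int]_n, x != 0 -> e <= qform S (intmx x).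
Proof.
move=> Ssym Spos ST.
have TS := mulmx1C ST.
have Tsym := invmx_sym Ssym ST.
have Tii i : T i i = qform S (row i T).
  by rewrite -qform_row Tsym TS mul1mx.
have T0 i : 0 < T i i.
  rewrite Tii Spos //; apply: contraTneq isT => Ti0.
  have := congr1 (fun M : 'rV_n => (M *m S) 0 i) Ti0.
  by rewrite -row_mul TS mul0mx !mxE eqxx => /eqP; rewrite oner_eq0.
have CS (x : 'rV[R]_n) i : x 0 i ^+ 2 <= qform S x * T i i.
  pose t := x 0 i / T i i; set y := row i T.
  have xSy : (x *m S *m y^T) 0 0 = x 0 i.
    by rewrite /y tr_row Tsym colE mulmxA -(mulmxA x) ST mulmx1 -colE !mxE.
  have ySx : (y *m S *m x^T) 0 0 = x 0 i.
    by rewrite -xSy -[y *m S *m x^T]trmxK [LHS]mxE !trmx_mul trmxK Ssym mulmxA.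
  have : 0 <= qform S (x - t *: y).
    by have [->|/Spos/ltW//] := eqVneq (x - t *: y) 0; rewrite /qform !mul0mx mxE.
  have -> : qform S (x - t *: y) = qform S x - x 0 i ^+ 2 / T i i.
    rewrite qform_subZ xSy ySx -Tii /t; field.
    by rewrite gt_eqF.
  by rewrite subr_ge0 ler_pdivrMr.
exists (1 + \sum_i T i i)^-1.
  by rewrite invr_gt0 ltr_pwDl // sumr_ge0 // => i _; rewrite ltW.
move=> x x0; have [i xi] : exists i, x 0 i != 0.
  apply/existsP; apply: contraR x0 => /existsPn x0; apply/eqP/rowP => i.
  by rewrite mxE; apply/eqP; rewrite -[_ == _]negbK x0.
have q0 : 0 < qform S (intmx x).
  by rewrite Spos // intmx_eq0.
have T1 : 0 < 1 + \sum_i T i i by rewrite ltr_pwDl // sumr_ge0 // => j _; rewrite ltW.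
rewrite -[leLHS]mul1r ler_pdivrMr //; apply: (@le_trans _ _ (intmx x 0 i ^+ 2)).
  rewrite mxE -rmorphXn /= -[1]/(1%:~R) ler_int; move: xi; move: (x 0 i) => a; lia.
apply: le_trans (CS _ _) _; rewrite ler_pM2l // (bigD1 i) //= addrCA lerDl.
by rewrite addr_ge0 // sumr_ge0 // => j _; rewrite ltW.
Qed.

(* A form of transference: a lattice basis all of whose vectors are short
   relative to some nonzero vector of the dual lattice.  The first basis vector
   is chosen nearly shortest among vectors of bases; its orthogonal projection
   (the Schur complement [S']) has a dual contained in the given one, and a
   reduced basis of the projection lifts with coefficients rounded to at most
   1/2, so near minimality bounds the first vector by the lifted ones. *)
Lemma dual_reduction m (S T : 'M[R]_m.+1) :
  S^T = S -> posdef S -> S *m T = 1%:M ->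
  exists (U : 'M[int]_m.+1) (z : 'rV[int]_m.+1),
    [/\ U \in unitmx, z != 0 &
        forall i, qform S (row i (intmx U)) * qform T (intmx z) <= 4 ^+ m].
Proof.
elim: m S T => [|m IH] S T Ssym Spos ST.
  exists 1%:M, 1%:M; split; rewrite ?unitmx1 ?matrix_nonzero1 //.
  move=> i; rewrite map_mx1 row1 expr0 (ord1 i).
  have -> : delta_mx 0 0 = 1%:M :> 'M[R]_1 by apply/matrixP=> a b; rewrite !mxE !ord1.
  rewrite /qform trmx1 !mulmx1 !mul1mx.
  have := congr1 (fun M : 'M_1 => M 0 0) ST; rewrite mxE big_ord1 => ->.
  by rewrite mxE.
have [e e0 eP] := posdef_int_lower_bound Ssym Spos ST.
pose X := {U : 'M[int]_m.+2 | U \in unitmx}.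
have rowN0 n (U : 'M[int]_n) i : U \in unitmx -> row i U != 0.
  move=> Uu; apply: contraTneq isT => /(congr1 (fun v : 'rV_n => (v *m invmx U) 0 i)).
  by rewrite -row_mul mulmxV // mul0mx !mxE eqxx => /eqP; rewrite oner_eq0.
have [|[U0 U0u] U0min] := @near_minimum X
    (fun U => qform S (intmx (row 0 (sval U)))) e (exist _ 1%:M (unitmx1 _ _)) e0.
  by move=> [U Uu]; apply: eP; apply: rowN0.
pose V0 := intmx U0; have V0u : V0 \in unitmx.
  by rewrite unitmxE det_map_mx rmorph_unit // -unitmxE.
have {}U0min U : U \in unitmx -> qform S (row 0 V0) <= 2 * qform S (intmx (row 0 U)).
  by move=> Uu; have := U0min (exist _ U Uu); rewrite /= map_row.
pose A : 'M_(1 + m.+1) := V0 *m S *m V0^T.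
pose B : 'M_(1 + m.+1) := (invmx V0)^T *m T *m invmx V0.
have Asym : A^T = A by rewrite !trmx_mul trmxK Ssym mulmxA.
have AB : A *m B = 1%:M.
  rewrite /A /B !mulmxA -(mulmxA _ _ (invmx V0)^T) -trmx_mul mulVmx // trmx1.
  by rewrite mulmx1 -(mulmxA V0) ST mulmx1 mulmxV.
have aE : A 0 0 = qform S (row 0 V0) by rewrite /A qform_row.
have qA y : qform S (y *m V0) = qform A y by rewrite qform_mulmx.
have qB y : qform T (y *m (invmx V0)^T) = qform B y by rewrite qform_mulmx trmxK.
clearbody A B; have a0 : 0 < A 0 0.
  by rewrite aE /V0 -map_row Spos // intmx_eq0 rowN0.
have an0 : A 0 0 != 0 by rewrite gt_eqF.
set a := A 0 0 in an0 a0 aE; pose b := ursubmx A; pose S' := schur_compl A.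
have qrow c x : qform A (row_mx c%:M x) =
    a * (c + (x *m b^T) 0 0 / a) ^+ 2 + qform S' x by exact: qform_row_mx.
have S'sym : S'^T = S'.
  have AE i j : A i j = A j i by rewrite -{1}Asym mxE.
  apply/matrixP => i j; rewrite /S' /schur_compl !mxE AE.
  by congr (_ - _ * _); apply: eq_bigr => k _; rewrite !mxE mulrC.
have S'pos : posdef S'.
  move=> x x0; have := qrow (- ((x *m b^T) 0 0 / a)) x.
  rewrite addNr expr0n mulr0 add0r => <-; rewrite -qA Spos //.
  apply: contraNneq x0 => /(congr1 (mulmx^~ (invmx V0))).
  rewrite mulmxK // mul0mx => /(congr1 (@rsubmx _ 1 1 m.+1)).
  by rewrite row_mxKr linear0 => ->.
have [U' [z' [U'u z'0 U'P]]] := IH _ _ S'sym S'pos (schur_complP Asym an0 AB).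
(* [mu i] is the component along the first basis vector of the vector to be lifted, and [k i] is a
   nearest integer, which [U1] subtracts. *)
pose mu i := (row i (intmx U') *m b^T) 0 0 / a.
pose k i : int := Num.floor (mu i + 2^-1).
pose U1 : 'M[int]_(1 + m.+1) := block_mx 1%:M 0 (\col_i - k i) U'.
have U1u : U1 \in unitmx.
  by rewrite unitmxE det_lblock det1 mul1r -unitmxE.
(* In the dual basis, a zero first coordinate means a form vanishing on the first basis vector;
   there the dual form is the block [drsubmx B]. The return to the old coordinates is
   contragredient. *)
pose z0 : 'rV[int]_m.+2 := row_mx (0 : 'rV_1) z'.
exists (U1 *m U0), (z0 *m (invmx U0)^T); split.
- by rewrite unitmx_mul U1u.
- apply: contraNneq z'0 => /(congr1 (mulmx^~ U0^T)).
  rewrite -mulmxA -trmx_mul mulmxV // trmx1 mulmx1 mul0mx.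
  move=> /(congr1 (@rsubmx _ 1 1 m.+1)).
  by rewrite row_mxKr linear0 => ->.
have qz : qform T (intmx (z0 *m (invmx U0)^T)) =
    qform (drsubmx B) (intmx z').
  have iV : intmx (invmx U0) = invmx V0.
    by apply: (can_inj (mulKmx V0u)); rewrite -map_mxM !mulmxV // map_mx1.
  have iz0 : intmx z0 = row_mx (0 : 'rV_1) (intmx z').
    by rewrite -(map_mx0 intr) -map_row_mx.
  by rewrite map_mxM -map_trmx iV iz0 qB qform_row0mx.
have qU i : qform S (row i (intmx (U1 *m U0))) = qform A (row i (intmx U1)).
  by rewrite map_mxM row_mul qA.
have qd i : qform A (row (rshift 1 i) (intmx U1)) =
    a * (mu i - (k i)%:~R) ^+ 2 + qform S' (row i (intmx U')).
  have -> : row (rshift 1 i) (intmx U1) =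
      row_mx (- (k i)%:~R)%:M (row i (intmx U')).
    rewrite map_block_mx /block_mx rowKd row_row_mx; congr row_mx.
    by apply/rowP => j; rewrite !ord1 !mxE eqxx mulr1n rmorphN.
  by rewrite qrow -/(mu i) (addrC (- _)).
have qdle i : qform A (row (rshift 1 i) (intmx U1)) <=
    a / 4 + qform S' (row i (intmx U')).
  rewrite qd lerD2r ler_pM2l //.
  have /andP[] := floor_itv (mu i + 2^-1); rewrite -/(k i) intrD.
  move: (mu i) ((k i)%:~R : R) => u v uv vu.
  have uv1 : 0 <= u - v + 2^-1 by lra.
  have vu1 : 0 <= v - u + 2^-1 by lra.
  by have := mulr_ge0 uv1 vu1; lra.
(* A transposition of rows makes the lifted vector the first of a basis, so near minimality gives
   [a <= 2 * (a / 4 + q)], with [q] its value after projection. *)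
have amin i : a <= 4 * qform S' (row i (intmx U')).
  have Pu : row_perm (tperm 0 (rshift 1 i : 'I_m.+2)) (U1 *m U0) \in unitmx.
    by rewrite row_permE !unitmx_mul unitmx_perm U1u.
  have := U0min _ Pu; rewrite -aE map_row.
  have -> : row 0 (intmx (row_perm (tperm 0 (rshift 1 i : 'I_m.+2)) (U1 *m U0))) =
            row (rshift 1 i) (intmx (U1 *m U0)).
    by apply/rowP => j; rewrite 4!mxE tpermL !mxE.
  by rewrite qU; have := qdle i; lra.
have qz0 : 0 <= qform (drsubmx B) (intmx z').
  rewrite -qz (qform_inv _ Ssym ST); set y := _ *m T.
  by have [->|/Spos/ltW//] := eqVneq y 0; rewrite /qform !mul0mx mxE.
(* The first vector costs the factor 4 of [a <= 4 * q]; for the others, [a / 4] and [q] each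
   contribute at most [4 ^ m]. *)
move=> i; rewrite qz qU exprS.
have b0 := U'P 0; have a4 := amin 0.
case: (@split_ordP 1 m.+1 i) => j ->.
  have -> : qform A (row (lshift m.+1 j) (intmx U1)) = a.
    have -> : row (lshift m.+1 j) (intmx U1) = row_mx 1%:M 0.
      rewrite map_block_mx /block_mx rowKu row_row_mx; congr row_mx.
        by apply/rowP => l; rewrite !ord1 !mxE eqxx.
      by apply/rowP => l; rewrite !mxE.
    by rewrite qrow mul0mx mxE mul0r addr0 expr1n mulr1 /qform !mul0mx mxE addr0.
  by apply: le_trans (ler_wpM2r qz0 a4) _; rewrite -mulrA ler_pM2l.
have bj := U'P j; have := ler_wpM2r qz0 (qdle j).
have c0 : 0 <= 4 ^+ m :> R by rewrite exprn_ge0.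
have := ler_wpM2r qz0 a4; rewrite !mulrDl; lra.
Qed.

End DualReduction.

(** * Rings of integers *)

Section Embeddings.
Variable L : fieldExtType rat.
Implicit Types (e : {rmorphism L -> algC}) (x y : L).

Lemma rmorph_scale_rat e (q : rat) x : e (q *: x) = ratr q * e x.
Proof.
rewrite -mulr_algl rmorphM; congr (_ * _).
exact: (fmorph_eq_rat (e \o in_alg L)).
Qed.

(** Artin's argument: subtracting [e i0 y] times the relation at [x] from the relation at [y * x]
    kills the coefficient at [i0]. By induction the shorter relation is trivial, so [v i = 0]
    whenever [y] separates [e i] from [e i0]. *)
Lemma embeddings_indep n (e : 'I_n -> {rmorphism L -> algC}) (v : 'I_n -> algC) :
  (forall i j, e i =1 e j -> i = j) ->
  (forall x, \sum_i v i * e i x = 0) -> forall i, v i = 0.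
Proof.
move=> e_inj; have [k] := ubnP #|[set i | v i != 0]|.
elim: k => // k IH in v *; rewrite ltnS => vk ve0 i0.
apply/eqP; apply: contraT => vi0.
have v0 i : i != i0 -> v i = 0.
  move=> ii0; have [y yi] : exists y, e i y != e i0 y.
    apply: contrapT => /forallNP ey; case/eqP: ii0; apply: e_inj => y.
    by have /negP/negPn/eqP := ey y.
  suff /eqP : v i * (e i y - e i0 y) = 0.
    by rewrite mulf_eq0 subr_eq0 (negbTE yi) orbF => /eqP.
  apply: (IH (fun j => v j * (e j y - e i0 y))).
  - apply: leq_trans vk; apply: proper_card; apply/properP; split.
      apply/fintype.subsetP => j; rewrite !inE; apply: contraNneq => ->.
      by rewrite mul0r.
    by exists i0; rewrite !inE // subrr mulr0 eqxx.
  - move=> x; transitivity (\sum_j v j * e j (y * x) - e i0 y * \sum_j v j * e j x).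
      rewrite mulr_sumr -sumrB; apply: eq_bigr => j _; rewrite rmorphM; ring.
    by rewrite !ve0 mulr0 subrr.
have := ve0 1; rewrite (bigD1 i0) //= rmorph1 mulr1 big1 ?addr0 => [/eqP|i ii0].
  by rewrite (negbTE vi0).
by rewrite v0 ?mul0r.
Qed.

(** Clearing denominators turns the relation into an integral expansion of 0, and such an expansion
    is unique. *)
Lemma integral_basis_free n (w : 'I_n -> L) (q : 'I_n -> rat) :
  integral_basis w -> \sum_j q j *: w j = 0 -> forall j, q j = 0.
Proof.
case=> _ wZ qw j.
pose c := [ffun j => numq (q j) * \prod_(i | i != j) denq (q i)].
pose D := \prod_i denq (q i).
have cE i : (c i)%:~R = D%:~R * q i :> rat.
  rewrite ffunE /D [in RHS](bigD1 i) //= !rmorphM /= -[X in _ = _ * X]divq_num_den.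
  have : (denq (q i))%:~R != 0 :> rat by rewrite intr_eq0 denq_neq0.
  by move: (denq _)%:~R (numq _)%:~R (\prod_(_ | _) _)%:~R => a b d d0; field.
have [c0 [_ c0u]] := wZ 0 (integral0 _).
have cu : c0 = c.
  apply: c0u; transitivity (D%:~R *: \sum_j q j *: w j); first by rewrite qw scaler0.
  by rewrite scaler_sumr; apply: eq_bigr => i _; rewrite scalerA -cE scaler_int.
have zu : c0 = [ffun=> 0].
  by apply: c0u; rewrite big1 // => i _; rewrite ffunE mulr0z.
have D0 : D != 0 by apply/prodf_neq0 => i _; rewrite denq_neq0.
have /esym/eqP := cE j; rewrite -cu zu ffunE mulf_eq0 intr_eq0 (negbTE D0).
by move/eqP.
Qed.

Lemma integral_basis_span n (w : 'I_n -> L) x :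
  \dim {:L} = n -> integral_basis w ->
  exists q : 'I_n -> rat, x = \sum_j q j *: w j.
Proof.
move=> dimL wP; pose W := [tuple w j | j < n].
have Wb : basis_of {:L} W.
  rewrite basisEfree subvf dimL size_tuple leqnn !andbT; apply/freeP => q q0.
  apply: (integral_basis_free wP); rewrite -[RHS]q0.
  by apply: eq_bigr => j _; rewrite -tnth_nth tnth_mktuple.
exists (fun j => coord W j x); rewrite {1}(coord_basis Wb (memvf x)).
by apply: eq_bigr => j _; rewrite -tnth_nth tnth_mktuple.
Qed.

(** A row vector killed by the matrix is a linear relation between the embeddings on [w], hence on
    all of [L]. *)
Lemma embedding_matrix_unit n (e : 'I_n -> {rmorphism L -> algC}) (w : 'I_n -> L) :
  \dim {:L} = n -> enumerates_embeddings e -> integral_basis w ->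
  \matrix_(i, j) e i (w j) \in unitmx.
Proof.
move=> dimL [e_inj _] wP; rewrite unitmxE unitfE.
apply/negP => /det0P[v v0 vE]; case/eqP: v0; apply/rowP => i; rewrite mxE.
apply: (embeddings_indep e_inj (v := fun i => v 0 i)) => x.
have [q ->] := integral_basis_span x dimL wP.
under eq_bigr do rewrite rmorph_sum mulr_sumr.
rewrite exchange_big big1 //= => j _.
have /rowP/(_ j) := vE; rewrite !mxE => vEj.
rewrite -[RHS](mulr0 (ratr (q j))) -[in RHS]vEj mulr_sumr.
by apply: eq_bigr => k _; rewrite !mxE rmorph_scale_rat mulrCA.
Qed.

End Embeddings.

Section SmallBasis.
Variables (L : fieldExtType rat) (m : nat).
Variables (e : 'I_m.+1 -> {rmorphism L -> algC}) (w : 'I_m.+1 -> L) (d : int).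
Hypothesis dimL : \dim {:L} = m.+1.
Hypothesis eP : enumerates_embeddings e.
Hypothesis wP : integral_basis w.

Let E := \matrix_(i, j) e i (w j).
Hypothesis dE : d%:~R = (\det E) ^+ 2.

Let Eu : E \in unitmx := embedding_matrix_unit dimL eP wP.

Local Notation intmx K := (map_mx (intr : int -> K)).
Local Notation toC := (map_mx algRval).

(** The Gram matrix of the basis [w] for the Euclidean structure of Minkowski's embedding, the sum
    over [i] of [e i x] times the conjugate of [e i y]. *)
Let gram : 'M[algC]_m.+1 := E^T *m map_mx Num.conj E.

(** Complex conjugation only permutes the embeddings, so it fixes the entries. *)
Lemma gram_real i j : gram i j \is Num.real.
Proof.
have [e_inj e_surj] := eP.
have /boolp.choice[s sP] : forall l, exists k, Num.conj \o e l =1 e k.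
  by move=> l; exact: (e_surj (Num.conj \o e l)).
have s_inj : injective s.
  move=> a b sab; apply: e_inj => x; apply: (inv_inj (@conjCK algC)).
  by have := sP a x; rewrite sab -(sP b x).
apply/CrealP; rewrite !mxE rmorph_sum (reindex_inj s_inj) /=.
apply: eq_bigr => l _; rewrite rmorphM !mxE /= -!sP /= !conjCK.
by rewrite mulrC; congr (_ * _); rewrite conjCK.
Qed.

(** The same matrix over the archimedean real field [algR], to which the reduction applies. *)
Let S : 'M[algR]_m.+1 := \matrix_(i, j) in_algR (gram_real i j).

Lemma toC_gram : toC S = gram.
Proof. by apply/matrixP => i j; rewrite !mxE. Qed.

Lemma qform_gram (x : 'rV[algR]_m.+1) :
  algRval (qform S x) = \sum_i `|\sum_j algRval (x 0 j) * e i (w j)| ^+ 2.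
Proof.
transitivity (qform gram (toC x)).
  by rewrite -toC_gram /qform map_trmx -!map_mxM [RHS]mxE.
have -> : qform gram (toC x) =
    ((toC x *m E^T) *m (map_mx Num.conj (toC x *m E^T))^T) 0 0.
  rewrite /qform /gram map_mxM trmx_mul -!map_trmx trmxK !mulmxA; congr ((_ *m _) 0 0).
  apply/matrixP => i j; rewrite !mxE; apply/esym/CrealP; exact: algRvalP.
rewrite mxE; apply: eq_bigr => i _; rewrite normCK !mxE; congr (_ * _^* ).
  by apply: eq_bigr => j _; rewrite !mxE.
by apply: eq_bigr => j _; rewrite !mxE.
Qed.

Lemma gram_sym : S^T = S.
Proof.
apply/matrixP => i j; apply: val_inj; rewrite !mxE /=.
rewrite -(CrealP (gram_real j i)) !mxE rmorph_sum /= [RHS]mxE.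
by apply: eq_bigr => l _; rewrite rmorphM !mxE /= conjCK mulrC.
Qed.

Lemma gram_unit : S \in unitmx.
Proof.
rewrite -(map_unitmx algRval) toC_gram unitmx_mul unitmx_tr Eu.
by rewrite map_unitmx.
Qed.

Lemma gram_posdef : posdef S.
Proof.
move=> x x0; rewrite -[_ < _]/(algRval 0 < algRval (qform S x)).
rewrite qform_gram lt0r; apply/andP; split; last first.
  by apply: sumr_ge0 => i _; rewrite exprn_ge0.
apply: contraNneq x0 => /eqP; rewrite psumr_eq0; last first.
  by move=> i _; apply: exprn_ge0.
move=> /allP y0; rewrite -(map_mx_eq0 algRval); apply/eqP.
have EuT : E^T \in unitmx by rewrite unitmx_tr.
apply: (can_inj (mulmxK EuT)); rewrite mul0mx; apply/rowP => i.
have := y0 i (mem_index_enum _).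
rewrite expf_eq0 /= normr_eq0 => /eqP yi; rewrite !mxE -[RHS]yi.
by apply: eq_bigr => j _; rewrite !mxE.
Qed.

(* [z] is an integral linear form on the ring of integers and [beta] gives its
   coordinates on the embeddings; the matrix of the bilinear form [z (x * y)]
   is integral with determinant [d * \prod_i beta i]. *)
Lemma dual_vector_norm (z : 'rV[int]_m.+1) (beta : 'I_m.+1 -> algC) :
  z != 0 -> (forall j, \sum_i beta i * e i (w j) = (z 0 j)%:~R) ->
  1 <= `|d|%:~R * \prod_i `|beta i|.
Proof.
move=> z0 betaP; have [w_int wZ] := wP.
have /boolp.choice[c cP] : forall jk : 'I_m.+1 * 'I_m.+1,
    exists c : {ffun 'I_m.+1 -> int}, w jk.1 * w jk.2 = \sum_l w l *~ c l.
  move=> jk; have [c [cE _]] := wZ _ (integral_mul (w_int jk.1) (w_int jk.2)).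
  by exists c.
pose M : 'M[int]_m.+1 := \matrix_(j, k) \sum_l z 0 l * c (j, k) l.
have ME : intmx algC M = E^T *m diag_mx (\row_i beta i) *m E.
  apply/matrixP => j k; rewrite mxE mxE rmorph_sum mxE /=.
  transitivity (\sum_i beta i * e i (w j * w k)); last first.
    by apply: eq_bigr => i _; rewrite rmorphM mul_mx_diag !mxE; ring.
  under [RHS]eq_bigr do rewrite (cP (j, k)) rmorph_sum mulr_sumr.
  rewrite exchange_big; apply: eq_bigr => l _ /=.
  rewrite intrM -betaP mulr_suml; apply: eq_bigr => i _.
  by rewrite raddfMz -[in RHS]mulrzr mulrA.
have detM : (\det M)%:~R = d%:~R * \prod_i beta i.
  rewrite -det_map_mx ME !det_mulmx det_tr det_diag dE.
  under eq_bigr do rewrite mxE.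
  ring.
(* A nonzero rational kernel vector would give a nonzero [x] with [beta i * e i x = 0] for all [i].
   As [e i x] is nonzero, every [beta i] vanishes, and so does [z]. *)
have detM0 : \det M != 0.
  apply: contra z0 => /eqP M0; have : \det (intmx rat M) == 0.
    by rewrite det_map_mx M0.
  case/det0P => v v0 vM; pose x := \sum_j v 0 j *: w j.
  have x0 : x != 0.
    apply: contraNneq v0 => x0; apply/eqP/rowP => j; rewrite mxE.
    exact: (integral_basis_free wP x0).
  have bx : \row_i (beta i * e i x) = 0.
    apply: (can_inj (mulmxK Eu)); rewrite mul0mx; apply/rowP => k.
    have /rowP/(_ k)/(congr1 (ratr : rat -> algC)) := vM.
    rewrite 2!mxE rmorph0 rmorph_sum /= => vk.
    rewrite [LHS]mxE [RHS]mxE -[RHS]vk.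
    transitivity (\sum_j ratr (v 0 j) * (intmx algC M) j k); last first.
      apply: eq_bigr => j _; rewrite rmorphM /=; congr (_ * _).
      by rewrite [LHS]mxE [in RHS]mxE ratr_int.
    under [RHS]eq_bigr do rewrite ME mxE mulr_sumr.
    rewrite exchange_big; apply: eq_bigr => i _ /=.
    rewrite !mxE rmorph_sum mulr_sumr mulr_suml; apply: eq_bigr => j _.
    rewrite rmorph_scale_rat mul_mx_diag !mxE; ring.
  apply/eqP/rowP => j; apply/eqP; rewrite mxE -(intr_eq0 algC) -betaP.
  apply/eqP; apply: big1 => i _; have /rowP/(_ i)/eqP := bx.
  by rewrite !mxE mulf_eq0 fmorph_eq0 (negbTE x0) orbF => /eqP ->; rewrite mul0r.
have -> : `|d|%:~R * \prod_i `|beta i| = `|(\det M)%:~R| :> algC.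
  by rewrite detM normrM normr_prod intr_norm.
by rewrite -intr_norm -[1]/(1%:~R) ler_int; move: detM0; move: (\det M) => a; lia.
Qed.

(** With [Q] the value of the dual form at the vector [z] of the reduction,
    [|e i (v j)| ^ 2 * Q <= 4 ^ m], while the norm bound gives [1 <= |d| ^ 2 * Q ^ (m + 1)].
    Eliminating [Q] bounds the conjugates. *)
Lemma small_integral_basis :
  exists v : 'I_m.+1 -> L,
    [/\ forall j, integralOver (intr : int -> L) (v j),
        \matrix_(i, j) e i (v j) \in unitmx &
        forall i j, `|e i (v j)| ^+ m.+1 <= 2 ^+ (m * m.+1) * `|d|%:~R].
Proof.
have ST := mulmxV gram_unit; set T := invmx S in ST.
have [U [z [Uu z0 UzP]]] := dual_reduction gram_sym gram_posdef ST.
pose v j := \sum_k w k *~ U j k; exists v.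
have ev i j : e i (v j) = \sum_k (U j k)%:~R * e i (w k).
  rewrite rmorph_sum; apply: eq_bigr => k _.
  by rewrite raddfMz mulrzl.
split.
- move=> j; rewrite /v; apply: big_ind => [|x y|k _].
  + exact: integral0.
  + exact: integral_add.
  by rewrite -mulrzr; apply: integral_mul; [apply: wP.1|apply: integral_id].
- have -> : \matrix_(i, j) e i (v j) = E *m (intmx algC U)^T.
    apply/matrixP => i j; rewrite !mxE ev; apply: eq_bigr => k _.
    by rewrite !mxE mulrC.
  rewrite unitmx_mul Eu unitmx_tr unitmxE det_map_mx rmorph_unit // -unitmxE.
(* [y] represents the integral form [z] through the Gram matrix; [beta] collects the conjugates of
   its images, and its squared length is [Q]. *)
move=> i j; pose y := intmx algR z *m T.
pose beta k := Num.conj (\sum_l algRval (y 0 l) * e k (w l)).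
have betaP l : \sum_k beta k * e k (w l) = (z 0 l)%:~R.
  have : toC y *m gram = intmx algC z.
    rewrite -toC_gram -map_mxM -mulmxA (mulmx1C ST) mulmx1.
    by apply/matrixP => a b; rewrite !mxE rmorph_int.
  move/(congr1 (map_mx Num.conj))/rowP/(_ l).
  rewrite [in RHS]mxE [in RHS]mxE rmorph_int => <-.
  rewrite /gram mulmxA map_mxM [RHS]mxE; apply: eq_bigr => k _.
  rewrite [X in _ = _ * X]mxE [X in _ = _ * Num.conj X]mxE conjCK [E k l]mxE.
  congr (_ * _).
  rewrite /beta [RHS]mxE [X in _ = Num.conj X]mxE; congr Num.conj.
  by apply: eq_bigr => a _; rewrite !mxE.
have bd := dual_vector_norm z0 betaP.
pose Q := algRval (qform T (intmx algR z)).
have QE : Q = \sum_k `|beta k| ^+ 2.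
  rewrite /Q (qform_inv _ gram_sym ST) qform_gram.
  by apply: eq_bigr => k _; rewrite /beta norm_conjC.
have Q0 : 0 <= Q by rewrite QE sumr_ge0 // => k _; rewrite exprn_ge0.
have prodQ : (\prod_k `|beta k|) ^+ 2 <= Q ^+ m.+1.
  rewrite -prodrXl -[X in Q ^+ X]card_ord -prodr_const; apply: ler_prod => k _.
  rewrite exprn_ge0 //= QE (bigD1 k) //= lerDl sumr_ge0 // => a _.
  by rewrite exprn_ge0.
have dQ : 1 <= `|d|%:~R ^+ 2 * Q ^+ m.+1.
  apply: le_trans (ler_wpM2l _ prodQ); last by rewrite exprn_ge0 // ler0z.
  by rewrite -exprMn exprn_ege1.
have evQ : `|e i (v j)| ^+ 2 * Q <= 4 ^+ m.
  have : algRval (qform S (row j (intmx algR U)) * qform T (intmx algR z))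
      <= algRval (4 ^+ m).
    exact: UzP.
  rewrite [algRval (_ * _)](rmorphM algRval) /= qform_gram -/Q.
  have -> : algRval (4 ^+ m) = 4 ^+ m.
    by rewrite (rmorphXn algRval) (rmorph_nat algRval).
  apply: le_trans.
  apply: ler_wpM2r => //; rewrite (bigD1 i) //=.
  have -> : \sum_k algRval (row j (intmx algR U) 0 k) * e i (w k) = e i (v j).
    by rewrite ev; apply: eq_bigr => k _; rewrite !mxE rmorph_int.
  by rewrite lerDl sumr_ge0 // => a _; rewrite exprn_ge0.
rewrite -(@ler_pXn2r _ 2) ?nnegrE ?mulr_ge0 ?exprn_ge0 ?ler0z //.
have -> : (2 ^+ (m * m.+1) * `|d|%:~R) ^+ 2 = (4 ^+ m) ^+ m.+1 * `|d|%:~R ^+ 2 :> algC.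
  have -> : 4 = 2 ^+ 2 :> algC by rewrite -natrX.
  by rewrite exprMn -!exprM mulnC mulnA.
rewrite [leLHS]exprAC.
apply: le_trans (_ : (`|e i (v j)| ^+ 2) ^+ m.+1 * (`|d|%:~R ^+ 2 * Q ^+ m.+1) <= _).
  by rewrite ler_peMr // !exprn_ge0.
rewrite mulrCA mulrC -exprMn; apply: ler_wpM2r; first by rewrite exprn_ge0 // ler0z.
by rewrite lerXn2r // nnegrE ?mulr_ge0 ?exprn_ge0.
Qed.

End SmallBasis.

(** * Traces and counting *)

Lemma Aint_rmorph (L : fieldExtType rat) (tau : {rmorphism L -> algC}) x :
  integralOver (intr : int -> L) x -> tau x \in Aint.
Proof.
case=> p p_monic px; apply: (@root_monic_Aint (map_poly intr p)).
- have -> : map_poly intr p = map_poly tau (map_poly intr p) :> {poly algC}.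
    by rewrite -map_poly_comp; apply: eq_map_poly => c; rewrite /= rmorph_int.
  by rewrite fmorph_root.
- exact: monic_map.
- by apply/polyOverP => i; rewrite coef_map intr_int.
Qed.

Section CosetPermutations.
Variables (n : nat) (n_gt0 : (0 < n)%N) (G : {group 'S_n}) (r : nat).
Variables (g : 'I_n -> 'S_n) (pi : 'I_r -> 'S_n).
Let H := point_stab n_gt0 G.
Let o := Ordinal n_gt0.
Hypothesis rE : r = #|'N_G(H) : H|%g.
Hypothesis gP : adapted_coset_reps n_gt0 G r g.
Hypothesis piP : coset_permutations n_gt0 G g pi.

Lemma point_stabP h : reflect (h \in G /\ h o = o) (h \in H).
Proof.
rewrite inE; apply: (iffP andP) => [[hG /astab1P ho]|[hG ho]]; split => //.
exact/astab1P.
Qed.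

(** [H] is the stabilizer of [o], so the coset [H :* g i] is known from the point [g i o]. *)
Lemma coset_rep_orbit_inj : injective (fun i => g i o).
Proof.
have [gG g_inj _ _ _] := gP => i j gij; apply: g_inj => /=.
apply/rcoset_eqP; rewrite mem_rcoset; apply/point_stabP.
by rewrite groupM ?groupV ?gG // permM gij permK.
Qed.

Lemma rank_le_degree : (r <= n)%N.
Proof.
have [_ _ gH _ _] := gP; rewrite rE -/(indexg _ _) /indexg.
apply: (@leq_trans #|rcosets H G|).
  apply: subset_leq_card; apply/fintype.subsetP => _ /rcosetsP[x xN ->].
  by apply/rcosetsP; exists x => //; move: xN; rewrite inE => /andP[].
by rewrite gH (leq_trans (leq_imset_card _ _)) // cardE size_enum_ord.
Qed.

(* On the indices [i], which stand for the points [g i o], the permutation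
   [pi j] commutes with the action of [G]. *)
Lemma coset_permutations_comm (s : 'S_n) (j : 'I_r) (i i' : 'I_n) :
  s \in G -> g i' o = s (g i o) -> g (pi j i') o = s (g (pi j i) o).
Proof.
have [gG _ _ _ gN] := gP => sG gi'.
pose j' := widen_ord rank_le_degree j.
have gpi l : g (pi j l) o = g l (g j' o).
  have /rcoset_eqP := piP l (erefl : j' = j :> nat).
  rewrite mem_rcoset => /point_stabP[_]; rewrite !permM => ho.
  by apply: (can_inj (permK (g (pi j l))^-1%g)); rewrite permK ho.
have jN : g j' \in 'N(H)%g.
  have : (H :* g j' \subset 'N_G(H))%g by rewrite gN /= ltn_ord.
  by move/fintype.subsetP/(_ _ (rcoset_refl _ _)); rewrite inE => /andP[].
have hK : (g i' * (g i * s)^-1)%g \in H.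
  apply/point_stabP; split; first by rewrite groupM ?groupV ?groupM ?gG.
  by rewrite permM gi' -(permM (g i) s) permK.
rewrite !gpi; have -> : g i' = ((g i' * (g i * s)^-1) * (g i * s))%g by rewrite mulgKV.
rewrite !permM; congr (s (g i _)).
(* It remains that [h], which fixes [o], also fixes [g j' o]; this holds because [g j'] normalizes
   [H]. *)
move: hK; set h := (_ * _^-1)%g => hH.
have : (h ^ (g j')^-1)%g \in H by rewrite memJ_norm // groupV.
rewrite conjgE invgK => /point_stabP[_]; rewrite !permM => hgj.
by apply: (can_inj (permK (g j')^-1%g)); rewrite hgj permK.
Qed.

Hypothesis Gtrans : [transitive G, on [set: 'I_n]%SET | 'P].

(** The embeddings are renumbered by cosets, [f i] being the one at the point [g i o]. Galois
    automorphisms then permute the summands, and the sum is a rational algebraic integer. *)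
Lemma galois_trace_int (L : fieldExtType rat) (iota : {rmorphism L -> algC}) :
  has_galois_group G iota ->
  exists f : 'I_n -> {rmorphism L -> algC}, enumerates_embeddings f /\
    forall (x : L) (a : 'I_r -> nat), integralOver (intr : int -> L) x ->
      \sum_i \prod_j f (pi j i) x ^+ a j \in Num.int.
Proof.
case=> M [jM [e [psi [[Mgal Miota _] [e_inj e_surj] psiP translate]]]].
have rho_inj := coset_rep_orbit_inj; pose rho i := g i o.
have rhoV k : exists i, rho i = k.
  by exists (invF rho_inj k); apply: (f_invF rho_inj).
exists (fun i => e (rho i)); split.
  split=> [i j /e_inj/rho_inj//|tau].
  by have [k tauk] := e_surj tau; have [i ik] := rhoV k; exists i; rewrite ik.
move=> x a x_int; apply: Cint_rat_Aint; last first.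
  apply: rpred_sum => i _; apply: rpred_prod => j _; apply: rpredX.
  exact: Aint_rmorph.
have [psi_inj psi_im] := isomP psiP.
(* The closure is given to contain [range iota]; transitivity of [G] brings in the other conjugates
   of [x]. *)
have /boolp.choice[y yP] : forall k, exists y, e k x = jM y.
  move=> k; have [i0 iotaE] := e_surj iota.
  have [|y0 _ y0E] := Miota (iota x); first by exists x.
  have [s sG ->] := atransP2 Gtrans (finset.in_setT i0) (finset.in_setT k).
  move: sG; rewrite -psi_im => /morphimP[sigma sG _ ->].
  by exists (sigma y0); apply: translate => //; rewrite -iotaE.
pose Y := \sum_i \prod_j y (rho (pi j i)) ^+ a j.
have YE : jM Y = \sum_i \prod_j e (rho (pi j i)) x ^+ a j.
  rewrite rmorph_sum; apply: eq_bigr => i _; rewrite rmorph_prod.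
  by apply: eq_bigr => j _; rewrite rmorphXn yP.
have : Y \in fixedField 'Gal({:M} / 1)%g.
  apply/fixedFieldP; first exact: memvf.
  move=> sigma sG; apply: (fmorph_inj jM).
  have psiG : psi sigma \in G by rewrite -psi_im mem_morphim.
  have /boolp.choice[s' s'P] : forall i, exists i', rho i' = psi sigma (rho i).
    by move=> i; apply: rhoV.
  have s'_inj : injective s'.
    by move=> i j ij; apply/rho_inj/(@perm_inj _ (psi sigma)); rewrite -!s'P ij.
  rewrite YE (reindex_inj s'_inj) /= /Y !rmorph_sum; apply: eq_bigr => i _.
  rewrite !rmorph_prod; apply: eq_bigr => j _; rewrite !rmorphXn; congr (_ ^+ _).
  have -> : rho (pi j (s' i)) = psi sigma (rho (pi j i)).
    exact: coset_permutations_comm psiG (s'P i).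
  by symmetry; apply: translate => //; rewrite yP.
rewrite (galois_fixedField Mgal) => /vlineP[q Yq].
by rewrite -YE Yq rmorph_scale_rat rmorph1 mulr1 Crat_rat.
Qed.

End CosetPermutations.

Lemma counting_le_card (R : realType) (T : finType) (U : choiceType)
    (A : set U) (h : T -> U) :
  (A `<=` range h)%classic -> (counting A <= (#|T|%:R)%:E :> \bar R)%E.
Proof.
move=> Ah; have Afin : finite_set A.
  apply: sub_finite_set Ah _; apply: finite_image; exact: finite_finset.
rewrite /counting asboolT // lee_fin ler_nat -(size_codom h).
apply: uniq_leq_size; first exact: finmap.fset_uniq.
move=> x xA; have : x \in A by rewrite -(in_fset_set Afin).
by rewrite inE => /Ah[y _ <-]; apply: codom_f.
Qed.

Lemma mderiv_map_mpoly (R S : nzRingType) (f : {rmorphism R -> S}) n i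
    (p : mpoly n R) :
  mderiv i (map_mpoly f p) = map_mpoly f (mderiv i p).
Proof.
apply/mpolyP => m.
by rewrite mcoeff_deriv !mcoeff_map_mpoly /= mcoeff_deriv rmorphMn.
Qed.

Lemma map_mpoly_eq0 (R S : nzRingType) (f : {rmorphism R -> S}) n
    (p : mpoly n R) :
  injective f -> (map_mpoly f p == 0) = (p == 0).
Proof.
move=> f_inj; apply/eqP/eqP => [fp0|->]; last exact: raddf0.
apply/mpolyP => m; apply: f_inj.
by rewrite -mcoeff_map_mpoly fp0 !mcoeff0 rmorph0.
Qed.

Lemma meval_mmap (R : comNzRingType) k n (f : 'I_k -> mpoly n R) u x :
  meval x (mmap (@mpolyC n R) f u) = meval (fun p => meval x (f p)) u.
Proof.
rewrite [RHS]/meval /mmap rmorph_sum; apply: eq_bigr => m _.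
rewrite rmorphM /= mevalC /mmap1 rmorph_prod; congr (_ * _).
by apply: eq_bigr => i _; rewrite rmorphXn.
Qed.

(** The distinguished index contributes [t] and each of the other [k - 1] elements contributes 1;
    this is the common degree of the trace functions. *)
Lemma sum_exponent_of_subset r k t (B : {set 'I_r}) :
  B \in pointed_subsets r k -> \sum_j exponent_of_subset t B j = (k + t - 1)%N.
Proof.
rewrite inE => /andP[/eqP Bk /existsP[j0 /andP[j0B /eqP j00]]].
rewrite (bigD1 j0) //= ffunE j00 eqxx.
have -> : (\sum_(i | i != j0) exponent_of_subset t B i = #|B :\ j0|)%N.
  rewrite -sum1_card [RHS]big_mkcond [LHS]big_mkcond /=.
  apply: eq_bigr => i _; rewrite !inE ffunE -val_eqE /= j00.
  by case: eqP => //= _; case: (i \in B).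
by rewrite -Bk (cardsD1 j0 B) j0B; lia.
Qed.

(** The integer [n]-th root of [T], which will bound the trace values. *)
Lemma leq_root (T n : nat) : (0 < n)%N ->
  exists B, (B ^ n <= T)%N /\ forall b, (b ^ n <= T)%N -> (b <= B)%N.
Proof.
move=> n0; have ub b : (b ^ n <= T)%N -> (b <= T)%N.
  by apply: leq_trans; case: b => // b; rewrite -[leqLHS]expn1 leq_pexp2l.
have ex0 : exists b, (b ^ n <= T)%N by exists 0%N; rewrite exp0n.
by have [B BT Bmax] := ex_maxnP ex0 ub; exists B.
Qed.

(** The [n] distinct conjugates of [x] are roots of its minimal polynomial, so [x] generates [L] and
    the number [iota x] alone determines the subfield. *)
Lemma rmorph_range_generator (L : fieldExtType rat) n
    (f : 'I_n -> {rmorphism L -> algC}) (iota : {rmorphism L -> algC}) x :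
  \dim {:L} = n -> injective (fun i => f i x) ->
  range iota =
  [set z | exists p : {poly rat}, z = (map_poly ratr p).[iota x]]%classic.
Proof.
move=> dimL fx_inj.
have ratr_tau (tau : {rmorphism L -> algC}) (p : {poly rat}) :
    map_poly tau (map_poly (in_alg L) p) = map_poly ratr p.
  rewrite -map_poly_comp; apply: eq_map_poly => c /=.
  by rewrite rmorph_scale_rat rmorph1 mulr1.
have deg : (n <= adjoin_degree 1 x)%N.
  have [p pE] := polyOver1P (minPolyOver 1 x).
  have mp0 : map_poly ratr p != 0 :> {poly algC}.
    by rewrite -(ratr_tau iota) -pE map_poly_eq0 monic_neq0 // monic_minPoly.
  have : (size [seq f i x | i <- enum 'I_n] < size (map_poly ratr p : {poly algC}))%N.
    apply: max_poly_roots => //.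
      apply/allP => _ /mapP[i _ ->]; rewrite -(ratr_tau (f i)) -pE fmorph_root.
      exact: root_minPoly.
    by rewrite map_inj_uniq ?enum_uniq.
  rewrite size_map size_enum_ord -(ratr_tau iota) -pE size_map_poly.
  by rewrite size_minPoly ltnS.
have full : <<1; x>>%VS = {:L}%VS.
  apply/eqP; rewrite eqEdim subvf /= dim_Fadjoin dimv1 muln1.
  by rewrite (leq_trans _ deg) // dimL.
apply/seteqP; split => [_ [y _ <-]|_ [p ->]] /=.
  have /Fadjoin_polyP[q /polyOver1P[p ->] ->] : y \in <<1; x>>%VS.
    by rewrite full memvf.
  by exists p; rewrite -horner_map ratr_tau.
exists (map_poly (in_alg L) p).[x] => //.
by rewrite -horner_map ratr_tau.
Qed.

(* The fiber of the map [f] through a point off the zero locus of [Phi] is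
   cut out, coordinate by coordinate, by the nonzero polynomials [P q]. *)
Lemma jacobian_elimination n (f : 'I_n -> mpoly n int) :
  \det (jacobian f) != 0 ->
  exists (D : nat) (P : 'I_n -> ('I_n -> algC) -> {poly algC})
         (Phi : mpoly n algC),
    [/\ Phi != 0, forall q b, (size (P q b) <= D)%N &
        forall x, meval x Phi != 0 -> injective x /\
          forall q, let b p := meval x (map_mpoly intr (f p)) in
            P q b != 0 /\ root (P q b) (x q)].
Proof.
move=> detJ; pose F p := map_mpoly (intr : int -> algC) (f p).
have F_indep : forall u, mmap (@mpolyC n algC) F u = 0 -> u = 0.
  apply: jacobian_alg_indep.
  have -> : \matrix_(p, q) mderiv q (F p) = map_mx (map_mpoly intr) (jacobian f).
    by apply/matrixP => p q; rewrite !mxE mderiv_map_mpoly.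
  by rewrite det_map_mx map_mpoly_eq0 //; apply: intr_inj.
have /boolp.choice[D DP] : forall q, exists (D : nat) (u : 'I_D -> mpoly n algC),
    (exists s, u s != 0) /\
    \sum_(s < D) mmap (@mpolyC n algC) F (u s) * mpolyX algC (mnm1 q) ^+ s = 0.
  by move=> q; apply: mpoly_alg_dep.
have /all_sig[u uP] := fun q => cid (DP q).
have /all_sig[s us] := fun q => cid (uP q).1.
(* [Psi] vanishes unless the coordinates are distinct, which will make the chosen element a
   generator. *)
pose Psi : mpoly n algC :=
  \prod_i \prod_(j | j != i) (mpolyX algC (mnm1 i) - mpolyX algC (mnm1 j)).
pose P q b : {poly algC} := \sum_(s < D q) meval b (u q s) *: 'X^s.
(* By independence the nonzero [u q (s q)] stays nonzero when [F] is substituted; where its value is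
   nonzero, so is a coefficient of [P q b]. *)
exists (\max_q D q), P, ((\prod_q mmap (@mpolyC n algC) F (u q (s q))) * Psi).
split.
- rewrite mulf_neq0 //.
    by apply/prodf_neq0 => q _; apply: contraNneq (us q) => /F_indep->.
  apply/prodf_neq0 => i _; apply/prodf_neq0 => j ji.
  apply: contraTneq isT => /(congr1 (mcoeff (mnm1 i))).
  rewrite mcoeffB !mcoeffX eqxx mcoeff0.
  have -> : (mnm1 j == mnm1 i :> multinom n) = false.
    apply/eqP => /mnmP/(_ i); rewrite !mnm1E eqxx => /eqP.
    by rewrite (negbTE ji).
  by rewrite subr0 => /eqP; rewrite oner_eq0.
- move=> q b; apply: leq_trans (leq_bigmax q).
  apply: (big_ind (fun p : {poly algC} => size p <= D q)%N) => [|p1 p2 s1 s2|l _].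
  + by rewrite size_poly0.
  + by rewrite (leq_trans (size_polyD _ _)) // geq_max s1.
  + by rewrite (leq_trans (size_scale_leq _ _)) // size_polyXn.
move=> x; rewrite mevalM mulf_eq0 negb_or => /andP[]; rewrite !rmorph_prod /=.
move=> /prodf_neq0 ux /prodf_neq0 xx; split.
  move=> i j xij; apply/eqP; apply: contraT; rewrite eq_sym => ji.
  have := xx i isT; rewrite rmorph_prod => /prodf_neq0/(_ j ji) /=.
  by rewrite mevalB !mevalXU xij subrr eqxx.
move=> q; set b := (fun p : 'I_n => _); split.
  apply: contraNneq (ux q isT) => /(congr1 (fun p : {poly algC} => p`_(s q))).
  rewrite coef0 coef_sum (bigD1 (s q)) //= coefZ coefXn eqxx mulr1 big1 => [|l ls].
    by rewrite addr0 meval_mmap => ->.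
  by rewrite coefZ coefXn eq_sym -[(l : nat) == _]/(l == s q) (negbTE ls) mulr0.
apply/eqP; have := congr1 (meval x) (uP q).2; rewrite rmorph_sum rmorph0 => <-.
rewrite horner_sum; apply: eq_bigr => l _.
by rewrite hornerZ hornerXn rmorphM rmorphXn /= mevalXU meval_mmap.
Qed.

Lemma small_generic_element (L : fieldExtType rat) n (d : int) Phi
    (f : 'I_n -> {rmorphism L -> algC}) :
  (0 < n)%N -> \dim {:L} = n -> enumerates_embeddings f ->
  is_discriminant n L d -> Phi != 0 ->
  exists x, [/\ integralOver (intr : int -> L) x,
    meval (fun i => f i x) Phi != 0 &
    forall i, `|f i x| ^+ n <=
      ((n * msize Phi) ^ n * 2 ^ (n * n) * `|d|)%:R].
Proof.
case: n Phi f => // m Phi f _ dimL [f_inj f_surj] [e [w [eP wP dE]]] Phi0.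
have [v [v_int vu vle]] := small_integral_basis dimL eP wP dE.
have [e_inj e_surj] := eP.
have /boolp.choice[s sP] : forall i, exists k, f i =1 e k by move=> i; apply: e_surj.
have s_inj : injective s.
  by move=> i j ij; apply: f_inj => x; rewrite !sP ij.
pose V := \matrix_(j, i) f i (v j).
have Vu : V \in unitmx.
  have -> : V = (row_perm (perm s_inj) (\matrix_(i, j) e i (v j)))^T.
    by apply/matrixP => j i; rewrite !mxE permE sP.
  by rewrite unitmx_tr row_permE unitmx_mul unitmx_perm.
have [c cP] := mpoly_grid_neq0 Phi0 Vu.
pose x := \sum_j (c j)%:R * v j.
have fx i : f i x = \sum_j (c j)%:R * f i (v j).
  by rewrite rmorph_sum; apply: eq_bigr => j _; rewrite rmorphM rmorph_nat.
exists x; split.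
- apply: big_ind => [|y z|j _]; [exact: integral0|exact: integral_add|].
  by apply: integral_mul; [apply: integral_nat|apply: v_int].
- rewrite (meval_eq (v2 := fun i => \sum_j (c j)%:R * V j i)) // => i.
  by rewrite fx; apply: eq_bigr => j _; rewrite mxE.
(* The exponent [m * m.+1] of the basis bound is enlarged to the square of the degree. *)
move=> i; pose B : algC := (2 ^ (m.+1 * m.+1) * `|d|)%:R.
pose rho := m.+1.-root B.
have rho0 : 0 <= rho by rewrite rootC_ge0 // ler0n.
have rhoB : rho ^+ m.+1 = B by rewrite rootCK.
have vrho j : `|f i (v j)| <= rho.
  rewrite -(@ler_pXn2r _ m.+1) ?nnegrE // rhoB sP; apply: le_trans (vle _ _) _.
  rewrite /B natrM natrX -[(`|d|)%:R]/((`|d|%N : int)%:~R) abszE.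
  apply: ler_wpM2r; first by rewrite ler0z.
  by rewrite ler_eXn2l ?ltr1n // leq_mul2r leqnSn orbT.
have xrho : `|f i x| <= (m.+1 * msize Phi)%:R * rho.
  rewrite fx; apply: le_trans (ler_norm_sum _ _ _) _.
  rewrite natrM -mulrA mulr_natl -[X in _ *+ X]card_ord -sumr_const.
  apply: ler_sum => j _; rewrite normrM normr_nat ler_pM //.
  by rewrite ler_nat ltnW.
apply: le_trans (_ : ((m.+1 * msize Phi)%:R * rho) ^+ m.+1 <= _).
  by rewrite lerXn2r ?nnegrE ?mulr_ge0 ?ler0n.
by rewrite exprMn rhoB /B -natrX -natrM mulnA.
Qed.

Lemma trace_bound n r (pi : 'I_r -> 'S_n) (a : 'I_r -> nat) (x : 'I_n -> algC)
    (B : nat) : (0 < n)%N ->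
  (forall i, `|x i| ^+ n <= B%:R) ->
  `|\sum_i \prod_j x (pi j i) ^+ a j| ^+ n <= (n ^ n * B ^ (\sum_j a j))%:R.
Proof.
move=> n0 xB; pose rho : algC := n.-root B%:R.
have rho0 : 0 <= rho by rewrite rootC_ge0 // ler0n.
have rhoB : rho ^+ n = B%:R by rewrite rootCK.
have xrho i : `|x i| <= rho by rewrite -(@ler_pXn2r _ n) ?nnegrE // rhoB.
have trho : `|\sum_i \prod_j x (pi j i) ^+ a j| <= n%:R * rho ^+ (\sum_j a j).
  apply: le_trans (ler_norm_sum _ _ _) _.
  rewrite mulr_natl -[X in _ *+ X]card_ord -sumr_const; apply: ler_sum => i _.
  rewrite normr_prod expr_sum; apply: ler_prod => j _.
  by rewrite normr_ge0 normrX lerXn2r ?nnegrE.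
apply: le_trans (_ : (n%:R * rho ^+ (\sum_j a j)) ^+ n <= _).
  by rewrite lerXn2r ?nnegrE ?mulr_ge0 ?ler0n ?exprn_ge0.
by rewrite exprMn exprAC rhoB natrM !natrX.
Qed.

Lemma meval_trace_function n r (pi : 'I_r -> 'S_n) a (x : 'I_n -> algC) :
  meval x (map_mpoly intr (trace_function pi a)) =
  \sum_i \prod_j x (pi j i) ^+ a j.
Proof.
rewrite /trace_function (raddf_sum (map_mpoly intr)) (raddf_sum (meval x)) /=.
apply: eq_bigr => i _.
rewrite (rmorph_prod (map_mpoly intr)) (rmorph_prod (meval x)) /=.
apply: eq_bigr => j _.
by rewrite (rmorphXn (map_mpoly intr)) (rmorphXn (meval x)) /= map_mpolyX mevalXU.
Qed.

(** A field is encoded by the trace values [b] of a small generic [x], the number of the embedding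
    equal to [iota], and the position of [iota x] among the roots of the corresponding [P q b]. *)
Lemma field_cover (n : nat) (n_gt0 : (0 < n)%N)
    (G : {group 'S_n}) (r : nat) (g : 'I_n -> 'S_n) (pi : 'I_r -> 'S_n)
    (m : nat) (a : 'I_n -> {ffun 'I_r -> nat}) :
  [transitive G, on [set: 'I_n]%SET | 'P] ->
  r = #|'N_G(point_stab n_gt0 G) : point_stab n_gt0 G|%g ->
  adapted_coset_reps n_gt0 G r g ->
  coset_permutations n_gt0 G g pi ->
  (forall p, \sum_j a p j = m)%N ->
  \det (jacobian (fun p => trace_function pi (a p))) != 0 ->
  exists (C D : nat) (K : ('I_n -> int) -> 'I_n * 'I_D -> set algC),
    forall (L : fieldExtType rat) (iota : {rmorphism L -> algC}) (d : int),
      \dim {:L} = n -> is_discriminant n L d -> has_galois_group G iota ->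
      exists b q, (forall p, `|b p| ^ n <= C * `|d| ^ m)%N /\
        range iota = K b q.
Proof.
move=> Gtrans rE gP piP am detJ.
have [D [P [Phi [Phi0 PD PhiP]]]] := jacobian_elimination detJ.
pose rts q (b : 'I_n -> int) :=
  sval (closed_field_poly_normal (P q (fun p => (b p)%:~R))).
pose A := ((n * msize Phi) ^ n * 2 ^ (n * n))%N.
(* [A * |d|] bounds the [n]-th powers of the conjugates of [x]; a sum of [n] terms of degree [m]
   adds the factor [n ^ n]. Positions past the last root get the default 0. *)
exists (n ^ n * A ^ m)%N, D, (fun b (qs : 'I_n * 'I_D) =>
  [set z | exists p : {poly rat}, z = (map_poly ratr p).[nth 0 (rts qs.1 b) qs.2]]%classic).
move=> L iota d dimL dP galP.
have [f [fP f_int]] := galois_trace_int rE gP piP Gtrans galP.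
have [x [x_int xPhi xle]] := small_generic_element n_gt0 dimL fP dP Phi0.
have [fx_inj PfP] := PhiP _ xPhi.
have /boolp.choice[b bE] : forall p, exists b : int,
    \sum_i \prod_j f (pi j i) x ^+ a p j = b%:~R.
  by move=> p; apply/intrP; apply: f_int.
have [_ /(_ iota)[q iotaE]] := fP.
have [] := PfP q; set R := P q _ => R0.
have RE : R = P q (fun p => (b p)%:~R).
  by congr (P q _); apply/funext => p; rewrite meval_trace_function bE.
rewrite -iotaE => Rx.
have RrtsE := svalP (closed_field_poly_normal R).
have rtsE : rts q b = sval (closed_field_poly_normal R) by rewrite /rts RE.
rewrite -rtsE in RrtsE.
have lR0 : lead_coef R != 0 by rewrite lead_coef_eq0.
have x_rts : iota x \in rts q b.
  by move: Rx; rewrite RrtsE rootZ // root_prod_XsubC.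
have sz : (size (rts q b) <= D)%N.
  apply: leq_trans (PD q (fun p => (b p)%:~R)); rewrite -RE [in leqRHS]RrtsE.
  by rewrite size_scale // size_prod_XsubC leqnSn.
have ltD : (index (iota x) (rts q b) < D)%N.
  by apply: leq_trans sz; rewrite index_mem.
exists b, (q, Ordinal ltD); split => [p|]; last first.
  by rewrite (rmorph_range_generator iota dimL fx_inj) /= nth_index.
have := trace_bound pi (a p) n_gt0 xle.
rewrite bE -intr_norm -natr_absz -natrX ler_nat am; move/leq_trans; apply.
by rewrite expnMn mulnA.
Qed.

Theorem theoremA (R : realType) (n : nat) (n_gt0 : (0 < n)%N)
    (G : {group 'S_n}) (r : nat) (g : 'I_n -> 'S_n) (pi : 'I_r -> 'S_n)
    (k t : nat) :
  [transitive G, on [set: 'I_n]%SET | 'P] ->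
  r = #|'N_G(point_stab n_gt0 G) : point_stab n_gt0 G|%g ->
  adapted_coset_reps n_gt0 G r g ->
  coset_permutations n_gt0 G g pi ->
  (3 <= r)%N ->
  (2 <= k <= r - 1)%N ->
  (2 <= t)%N ->
  (n <= 'C(r - 1, k - 1))%N ->
  (exists idx : 'I_n -> 'I_#|pointed_subsets r k|,
     injective (fun p => exponent_vector t (idx p)) /\
     \det (jacobian (fun p => trace_function pi (exponent_vector t (idx p))))
       != 0) ->
  exists C X0 : R, 0 < C /\
    forall X : R, 0 < X -> X0 <= X ->
      (field_count X G <= (C * X ^+ (k + t - 1))%:E)%E.
Proof.
move=> Gtrans rE gP piP _ _ _ _ [idx [_ detJ]].
set m := (k + t - 1)%N.
have am p : (\sum_j exponent_vector t (idx p) j)%N = m.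
  exact: sum_exponent_of_subset (enum_valP _).
have [C [D [K KP]]] := field_cover Gtrans rE gP piP am detJ.
(* The cover below has [(2 * B + 1) ^ n * n * D] members, where the first factor is at most
   [3 ^ n * (T + 1)] and [T + 1 <= (C + 1) * X ^ m]. The last successor keeps the constant positive
   even if [D] is 0. *)
exists ((3 ^ n * C.+1 * (n * D)).+1%:R), 1; split; first by rewrite ltr0n.
move=> X X0 X1; have Xm1 : 1 <= X ^+ m by rewrite exprn_ege1.
have CX0 : 0 <= C%:R * X ^+ m by rewrite mulr_ge0 // exprn_ge0 // ltW.
pose T := Num.truncn (C%:R * X ^+ m).
have [B [BT Bmax]] := leq_root T n_gt0.
pose I : finType := ({ffun 'I_n -> 'I_(B.*2).+1} * ('I_n * 'I_D))%type.
pose h (cq : I) := K (fun p => (cq.1 p : nat)%:Z - B%:Z) cq.2.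
have cover : (number_fields X G `<=` range h)%classic.
  move=> _ [L [iota [-> dimL [d dP dX] galP]]].
  have [b [q [bC ->]]] := KP _ _ _ dimL dP galP.
  have bB p : (`|b p| <= B)%N.
    apply: Bmax; apply: leq_trans (bC p) _; rewrite /T truncn_ge_nat //.
    rewrite natrM natrX ler_wpM2l // lerXn2r ?nnegrE ?ler0n ?(ltW X0) //.
  exists ([ffun p => inord (absz (b p + B%:Z))], q) => //.
  rewrite /h /=; congr (K _ _); apply/funext => p; rewrite ffunE inordK.
    by move: (bB p); lia.
  by move: (bB p); lia.
apply: le_trans (counting_le_card R cover) _.
rewrite lee_fin !card_prod card_ffun !card_ord.
(* For [B = 0] the box is a single point; otherwise [2 * B + 1 <= 3 * B]. *)
have Bn : ((B.*2).+1 ^ n <= 3 ^ n * T.+1)%N.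
  have [->|B0] := posnP B; first by rewrite exp1n muln_gt0 expn_gt0.
  apply: leq_trans (_ : (3 * B) ^ n <= _)%N.
    by rewrite leq_exp2r //; lia.
  by rewrite expnMn leq_mul2l (leq_trans BT) ?orbT.
have TX : T.+1%:R <= C.+1%:R * X ^+ m.
  rewrite -[T.+1]addn1 -[C.+1]addn1 !natrD mulrDl mul1r lerD //.
  by rewrite truncn_le.
apply: le_trans (_ : (3 ^ n * T.+1 * (n * D))%:R <= _).
  by rewrite ler_nat leq_mul2r Bn orbT.
rewrite -[(_ * (n * D)).+1]addn1 natrD mulrDl mul1r.
apply: le_trans (_ : (3 ^ n * C.+1 * (n * D))%:R * X ^+ m <= _); last first.
  by rewrite lerDl (le_trans ler01).
rewrite !natrM [leRHS]mulrAC ler_wpM2r ?mulr_ge0 //.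
by rewrite -mulrA ler_wpM2l.
Qed.
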